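(* Let $n\ge 4$ be an integer and let $\ell=\operatorname{lcm}(3,n)$. The automorphism group of the minimal regular cover of the $n$-antiprism, with its distinguished generators $a,b,c$ (in this order, i.e. $a=\rho_0$, $b=\rho_1$, $c=\rho_2$), is the Coxeter group $[\ell,4]$ subject to the single extra relation $(c(ab)^2cbc(ab)^2)^2=id$; that is, it is the group with presentation $$\langle a,b,c \mid a^2=b^2=c^2=(ac)^2=(bc)^4=(ab)^{\ell}=(c(ab)^2cbc(ab)^2)^2=id\rangle .$$
   Context: An abstract polyhedron $\mathcal{P}$ is a partially ordered set such that: (P1) it has a unique minimum face $F_{-1}$ and a unique maximum face $F_3$; (P2) every maximal totally ordered subset (flag) contains $F_{-1}$ and $F_3$ and has exactly $5$ elements (so there is a rank function; the elements of rank $0,1,2$ are vertices, edges, faces); (P3) it is strongly connected, meaning every section $G/F=\{H: F\le H\le G\}$ is connected, where a poset of rank $n$ is connected if $n\le 1$ or any two of its proper faces are joined by a finite sequence of proper faces with consecutive ones incident (comparable); (P4) every edge is incident to exactly two vertices and exactly two faces, and if a vertex $V$ is incident to a face $F$ there are exactly two edges incident to both. For a flag $\Psi$ and $i\in\{0,1,2\}$, $\Psi^i$ denotes the unique flag differing from $\Psi$ exactly in its element of rank $i$ (the $i$-adjacent flag). $\Gamma(\mathcal{P})$ is the automorphism group of $\mathcal{P}$; $\mathcal{P}$ is regular if $\Gamma(\mathcal{P})$ is transitive on flags. For a regular $\mathcal{P}$ with base flag $\Phi$, the distinguished generators of $\Gamma(\mathcal P)$ are the involutions $\rho_i$ with $\Phi\rho_i=\Phi^i$,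 $i=0,1,2$. The monodromy group $\mathrm{Mon}(\mathcal{Q})=\langle r_0,r_1,r_2\rangle$ of a polyhedron $\mathcal Q$ is the group of permutations of its flags generated by $r_i:\Psi\mapsto\Psi^i$, acting on the right (words are read from left to right). A regular polyhedron $\mathcal{P}$ covers $\mathcal{Q}$ if there is a group homomorphism $\Gamma(\mathcal{P})\to\mathrm{Mon}(\mathcal{Q})$ with $\rho_i\mapsto r_i$ for $i=0,1,2$. $\mathcal{P}$ is a minimal regular cover of $\mathcal{Q}$ if $\mathcal{P}$ is regular, covers $\mathcal{Q}$, and any regular polyhedron $\mathcal{R}$ that covers $\mathcal{Q}$ and is covered by $\mathcal{P}$ equals $\mathcal{P}$. (It is known that every polyhedron $\mathcal{Q}$ has a unique minimal regular cover up to isomorphism, namely the regular polyhedron whose automorphism group with distinguished generators is $\mathrm{Mon}(\mathcal{Q})$ with generators $r_0,r_1,r_2$, whenever $\mathrm{Mon}(\mathcal Q)$ is a string C-group; this always holds for polyhedra.) The $n$-antiprism is the face lattice of the convex $n$-gonal antiprism: vertices $u_i,v_i$ ($i\in\mathbb{Z}/n$), edges $u_iu_{i+1}$, $v_iv_{i+1}$, $u_iv_i$, $u_iv_{i+1}$, and faces the two $n$-gons $u_0\cdots u_{n-1}$, $v_0\cdots v_{n-1}$ and the $2n$ triangles $u_iu_{i+1}v_{i+1}$ and $v_iv_{i+1}u_i$. The Coxeter group $[p,q]$ is $\langle a,b,c\mid a^2=b^2=c^2=(ac)^2=(ab)^p=(bc)^q=id\rangle$. *)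

(* Defs.v *)
From HB Require Import structures.
From mathcomp Require Import all_boot all_order all_algebra generic_quotient.
From mathcomp Require Import all_classical.

Set Implicit Arguments.
Unset Strict Implicit.
Unset Printing Implicit Defensive.

Import Order.TTheory.
Local Open Scope order_scope.
Local Open Scope quotient_scope.
Local Open Scope group_scope.
Local Open Scope classical_set_scope.
Local Open Scope card_scope.

(* Permutations act on the right: s * t is "s, then t". *)
Section Permutations.
Variable T : choiceType.

Definition Sym : Type := {f : T -> T | `[< bijective f >]}.
HB.instance Definition _ := SubChoice.on Sym.

Definition sym_fun (s : Sym) : T -> T := val s.
Coercion sym_fun : Sym >-> Funclass.

Implicit Types s t : Sym.

Lemma symP s t : s =1 t -> s = t.
Proof. by move=> st; apply/val_inj/funext. Qed.

Lemma sym_bij s : bijective s.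
Proof. exact: asboolW (valP s). Qed.

Definition sym_one : Sym := Sub (@idfun T) (asboolT (@Bijective T T idfun idfun (fun=> erefl) (fun=> erefl))).
Definition sym_mul s t : Sym :=
  Sub (t \o s) (asboolT (bij_comp (sym_bij t) (sym_bij s))).

Fact sym_has_inv s : exists t : Sym, cancel s t /\ cancel t s.
Proof.
have [g sK gK] := sym_bij s.
by exists (Sub g (asboolT (Bijective gK sK))).
Qed.
Definition sym_inv s : Sym := sval (cid (sym_has_inv s)).

Fact sym_mulA : associative sym_mul.
Proof. by move=> s t u; apply: symP. Qed.
Fact sym_mul1s : left_id sym_one sym_mul.
Proof. by move=> s; apply: symP. Qed.
Fact sym_muls1 : right_id sym_one sym_mul.
Proof. by move=> s; apply: symP. Qed.
Fact sym_mulVs : left_inverse sym_one sym_inv sym_mul.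
Proof.
move=> s; apply: symP => x; rewrite /sym_inv.
by case: cid => t [sK tK] /=; exact: tK.
Qed.
Fact sym_mulsV : right_inverse sym_one sym_inv sym_mul.
Proof.
move=> s; apply: symP => x; rewrite /sym_inv.
by case: cid => t [sK tK] /=; exact: sK.
Qed.
HB.instance Definition _ :=
  isGroup.Build Sym sym_mulA sym_mul1s sym_muls1 sym_mulVs sym_mulsV.

End Permutations.

Section GeneratedSubgroup.
Variables (G : groupType) (S : set G).

Definition generated : set G := smallest [set H | group_closed (mem H)] S.

Fact generated_group_closed : group_closed (fun x => `[< generated x >]).
Proof.
split=> [|x y xS yS]; apply/asboolP => H [clH SH].
  by rewrite -in_setE; exact: clH.1.
rewrite -in_setE; apply: clH.2; rewrite in_setE.
  by apply: (asboolW xS).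
by apply: (asboolW yS).
Qed.

Definition subgroup_gen : Type := {x : G | `[< generated x >]}.
HB.instance Definition _ := SubChoice.on subgroup_gen.
HB.instance Definition _ :=
  SubChoice_isSubGroup.Build _ _ subgroup_gen generated_group_closed.

End GeneratedSubgroup.

Section Presentation.
Variable X : choiceType.

(* Words in the letters x (encoded as (x, true)) and x^-1 (as (x, false)). *)
Definition word := seq (X * bool).

Definition letter (x : X) : word := [:: (x, true)].
Definition word_inv (w : word) : word := rev [seq (p.1, ~~ p.2) | p <- w].
Definition word_pow (w : word) (k : nat) : word := flatten (nseq k w).

Variable R : seq word.

Inductive word_cong : word -> word -> Prop :=
| cong_refl w : word_cong w w
| cong_sym w1 w2 : word_cong w1 w2 -> word_cong w2 w1
| cong_trans w1 w2 w3 : word_cong w1 w2 -> word_cong w2 w3 -> word_cong w1 w3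
| cong_cat w1 w2 w1' w2' : word_cong w1 w1' -> word_cong w2 w2' ->
    word_cong (w1 ++ w2) (w1' ++ w2')
| cong_cancel x e : word_cong [:: (x, e); (x, ~~ e)] [::]
| cong_relator r : r \in R -> word_cong r [::].

Definition word_congb (w1 w2 : word) : bool := `[< word_cong w1 w2 >].

Fact word_congb_equiv : equiv_class_of word_congb.
Proof.
split=> [w|w1 w2|w2 w1 w3 /asboolP h12 /asboolP h23].
- exact/asboolP/cong_refl.
- by apply/asboolP/asboolP; exact: cong_sym.
- exact/asboolP/(cong_trans h12 h23).
Qed.
Canonical word_cong_equiv := EquivRelPack word_congb_equiv.

(* The group <X | R>. *)
Definition presented : Type := {eq_quot word_cong_equiv}.
HB.instance Definition _ := Choice.on presented.
HB.instance Definition _ := EqQuotient.on presented.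

Local Notation proj := (\pi_presented).

Definition presented_gen (x : X) : presented := proj (letter x).

Definition presented_one : presented := proj [::].
Definition presented_mul (g h : presented) : presented :=
  proj (repr g ++ repr h).
Definition presented_inv (g : presented) : presented := proj (word_inv (repr g)).

Lemma presented_eqP w1 w2 : proj w1 = proj w2 <-> word_cong w1 w2.
Proof. by split=> [/eqmodP/asboolP|h] //; apply/eqmodP/asboolP. Qed.

Lemma word_cong_repr w : word_cong (repr (proj w)) w.
Proof. by apply/presented_eqP; rewrite reprK. Qed.

Fact presented_mulA : associative presented_mul.
Proof.
move=> g h k; apply/presented_eqP.
apply: (cong_trans (cong_cat (cong_refl _) (word_cong_repr _))).
rewrite catA; apply: cong_cat; last exact: cong_refl.
exact/cong_sym/word_cong_repr.
Qed.
Fact presented_mul1g : left_id presented_one presented_mul.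
Proof.
move=> g; rewrite -[RHS]reprK; apply/presented_eqP.
by apply: (cong_cat (word_cong_repr [::]) (cong_refl _)).
Qed.
Fact presented_mulg1 : right_id presented_one presented_mul.
Proof.
move=> g; rewrite -[RHS]reprK; apply/presented_eqP.
by rewrite -[X in word_cong _ X]cats0; exact: cong_cat (cong_refl _) (word_cong_repr [::]).
Qed.

Lemma word_cong_mulV w : word_cong (w ++ word_inv w) [::].
Proof.
elim: w => [|[x e] w IHw]; first exact: cong_refl.
rewrite /word_inv /= rev_cons -cats1 -/(word_inv w) catA -cat1s.
apply: cong_trans (cong_cancel x e).
apply: (@cong_cat [:: (x, e)] _ [:: (x, e)] [:: (x, ~~ e)]).
  exact: cong_refl.
exact: (cong_cat IHw (cong_refl _)).
Qed.

Lemma word_invK : involutive word_inv.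
Proof.
move=> w; rewrite /word_inv map_rev revK -map_comp.
by rewrite -[RHS]map_id; apply: eq_map => -[x e] /=; rewrite negbK.
Qed.

Fact presented_mulgV : right_inverse presented_one presented_inv presented_mul.
Proof.
move=> g; apply/presented_eqP/(cong_trans _ (word_cong_mulV (repr g))).
exact: cong_cat (cong_refl _) (word_cong_repr _).
Qed.
Fact presented_mulVg : left_inverse presented_one presented_inv presented_mul.
Proof.
move=> g; apply/presented_eqP.
apply: (cong_trans _ (word_cong_mulV (word_inv (repr g)))).
by rewrite word_invK; exact: cong_cat (word_cong_repr _) (cong_refl _).
Qed.

HB.instance Definition _ := isGroup.Build presented
  presented_mulA presented_mul1g presented_mulg1 presented_mulVg presented_mulgV.

End Presentation.

Section Posets.
Variables (d : Order.disp_t) (P : tbPOrderType d).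
Implicit Types (x y F G : P) (A : set P).

Local Notation le_rel := (fun x y => x <= y).

Definition is_flag A : Prop :=
  total_on A le_rel /\ forall B, total_on B le_rel -> A `<=` B -> B `<=` A.

Definition flag : Type := {A : set P | `[< is_flag A >]}.
HB.instance Definition _ := SubChoice.on flag.

Definition flag_set (Psi : flag) : set P := val Psi.
Coercion flag_set : flag >-> set.

(* The rank of a face is counted from -1 (for the minimum) along a flag. *)
Definition has_rank (x : P) (r : int) : Prop :=
  exists (Psi : flag) (k : nat),
    [/\ (Psi : set P) x, [set y | (Psi : set P) y /\ y < x] #= `I_k
      & r = (k%:Z - 1)%R].

Definition connected_section (F G : P) : Prop :=
  (forall i j, has_rank F i -> has_rank G j -> (j - i - 1 <= 1 :> int)%R) \/
  forall x y, F < x < G -> F < y < G ->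
    exists s : seq P,
      [/\ path (fun u v => u >=< v) x s, last x s = y
        & all (fun u => F < u < G) s].

(* The minimum and maximum faces \bot and \top are part of tbPOrderType. *)
Definition is_polyhedron : Prop :=
  [/\ forall Psi : flag,
        [/\ (Psi : set P) \bot, (Psi : set P) \top & (Psi : set P) #= `I_5],
      forall F G, F <= G -> connected_section F G,
      forall e, has_rank e 1%R ->
        [set v | has_rank v 0%R /\ v >=< e] #= `I_2 /\
        [set f | has_rank f 2%R /\ f >=< e] #= `I_2
    & forall v f, has_rank v 0%R -> has_rank f 2%R -> v >=< f ->
        [set e | [/\ has_rank e 1%R, e >=< v & e >=< f]] #= `I_2].

Definition adjacent (i : 'I_3) (Psi Psi' : flag) : Prop :=
  Psi <> Psi' /\
  forall x, ~ has_rank x i%:Z -> ((Psi : set P) x <-> (Psi' : set P) x).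

Definition is_aut (s : Sym P) : bool := `[< {mono s : x y / x <= y} >].

Fact aut_group_closed : group_closed is_aut.
Proof.
split=> [|s t /asboolP autS /asboolP autT]; apply/asboolP => x y //.
have tVK z : (t : Sym P) ((t^-1 : Sym P) z) = z.
  by have /(congr1 (fun u : Sym P => u z)) := mulVg t.
by rewrite /= -autT !tVK autS.
Qed.

Definition Aut : Type := {s : Sym P | is_aut s}.
HB.instance Definition _ := SubChoice.on Aut.
HB.instance Definition _ :=
  SubChoice_isSubGroup.Build _ _ Aut aut_group_closed.

Definition aut_fun (g : Aut) : P -> P := sym_fun (val g).
Coercion aut_fun : Aut >-> Funclass.

Definition is_regular : Prop :=
  forall Phi Psi : flag, exists g : Aut, g @` Phi = Psi.

(* By rigidity of flags, these conditions determine the rho i and force them to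
   be involutions. *)
Definition distinguished (Phi : flag) (rho : 'I_3 -> Aut) : Prop :=
  forall i, exists2 Phi_i : flag, adjacent i Phi Phi_i & rho i @` Phi = Phi_i.

(* In a polyhedron, exactly one r satisfies is_monodromy i r, namely the map r_i
   sending each flag to its i-adjacent flag. *)
Definition is_monodromy (i : 'I_3) (r : Sym flag) : Prop :=
  forall Psi, adjacent i Psi (r Psi).

Definition Mon : Type :=
  subgroup_gen [set r | exists i, is_monodromy i r].
HB.instance Definition _ := Group.on Mon.

Definition mon_fun (m : Mon) : Sym flag := val m.

End Posets.

Definition poset_iso d d' (P : porderType d) (Q : porderType d') : Prop :=
  exists f : P -> Q, bijective f /\ {mono f : x y / x <= y}.

(* For regular P the choice of the base flag Phi is immaterial. *)
Definition covers d d' (P : tbPOrderType d) (Q : tbPOrderType d') : Prop :=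
  exists (Phi : flag P) (rho : 'I_3 -> Aut P), distinguished Phi rho /\
  exists f : {multiplicative Aut P -> Mon Q},
    forall i, is_monodromy i (mon_fun (f (rho i))).

Definition regular_polyhedron d (P : tbPOrderType d) : Prop :=
  is_polyhedron P /\ is_regular P.

(* Polyhedra are identified up to isomorphism. *)
Definition minimal_regular_cover d d'
    (P : tbPOrderType d) (Q : tbPOrderType d') : Prop :=
  [/\ regular_polyhedron P, covers P Q
    & forall d'' (R : tbPOrderType d''),
        regular_polyhedron R -> covers R Q -> covers P R -> poset_iso R P].

(* Each face is represented by its set of vertices, ordered by inclusion.
   'Z_n is the ring of integers mod n only for n >= 2. *)
Section Antiprism.
Local Open Scope set_scope.
Variable n : nat.

Definition antiprism_vertex : finType := ('Z_n * bool)%type.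
Local Notation V := antiprism_vertex.
Definition antiprism_u (i : 'Z_n) : V := (i, false).
Definition antiprism_v (i : 'Z_n) : V := (i, true).
Local Notation u := antiprism_u.
Local Notation v := antiprism_v.

Definition antiprism_edges : {set {set V}} :=
  [set [set u i; u (i + 1)%R] | i : 'Z_n] :|:
  [set [set v i; v (i + 1)%R] | i : 'Z_n] :|:
  [set [set u i; v i] | i : 'Z_n] :|:
  [set [set u i; v (i + 1)%R] | i : 'Z_n].

Definition antiprism_faces : {set {set V}} :=
  [set [set u i | i : 'Z_n]; [set v i | i : 'Z_n]] :|:
  [set [set u i; u (i + 1)%R; v (i + 1)%R] | i : 'Z_n] :|:
  [set [set v i; v (i + 1)%R; u i] | i : 'Z_n].

Definition antiprism_lattice : {set {set V}} :=
  [set finset.set0; finset.setT] :|: [set [set x] | x : V] :|: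
  antiprism_edges :|: antiprism_faces.

Definition antiprism : Type := {A : {set V} | A \in antiprism_lattice}.
HB.instance Definition _ := SubChoice.on antiprism.
HB.instance Definition _ := Finite.on antiprism.

Fact antiprism_display : Order.disp_t. Proof. exact: (Order.Disp tt tt). Qed.

Definition antiprism_le (A B : antiprism) : bool := val A \subset val B.

Fact antiprism_le_refl : reflexive antiprism_le.
Proof. by move=> A; exact: subxx. Qed.
Fact antiprism_le_anti : antisymmetric antiprism_le.
Proof. by move=> A B leAB; apply/val_inj/eqP; rewrite finset.eqEsubset. Qed.
Fact antiprism_le_trans : transitive antiprism_le.
Proof. by move=> B A C; exact: fintype.subset_trans. Qed.
HB.instance Definition _ := Order.Le_isPOrder.Build antiprism_display antiprism
  antiprism_le_refl antiprism_le_anti antiprism_le_trans.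

Fact antiprism_bot_subproof : (finset.set0 : {set V}) \in antiprism_lattice.
Proof. by rewrite !inE eqxx. Qed.
Fact antiprism_top_subproof : (finset.setT : {set V}) \in antiprism_lattice.
Proof. by rewrite !inE eqxx orbT. Qed.

Definition antiprism_bot : antiprism := Sub finset.set0 antiprism_bot_subproof.
Definition antiprism_top : antiprism := Sub finset.setT antiprism_top_subproof.

Fact antiprism_le0x (A : antiprism) : antiprism_bot <= A.
Proof. exact: (finset.sub0set (val A)). Qed.
Fact antiprism_lex1 (A : antiprism) : A <= antiprism_top.
Proof. exact: (finset.subsetT (val A)). Qed.
HB.instance Definition _ := Order.hasBottom.Build _ antiprism antiprism_le0x.
HB.instance Definition _ := Order.hasTop.Build _ antiprism antiprism_lex1.

End Antiprism.

Definition antiprism_cover_relators (l : nat) : seq (word 'I_3) :=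
  let a := letter (@Ordinal 3 0 isT) in
  let b := letter (@Ordinal 3 1 isT) in
  let c := letter (@Ordinal 3 2 isT) in
  let ab2 := word_pow (a ++ b) 2 in
  [:: word_pow a 2; word_pow b 2; word_pow c 2; word_pow (a ++ c) 2;
      word_pow (b ++ c) 4; word_pow (a ++ b) l;
      word_pow (c ++ ab2 ++ c ++ b ++ c ++ ab2) 2].

(* Main.v *)
Require Import Defs.
From HB Require Import structures.
From mathcomp Require Import all_boot all_order all_algebra.
From mathcomp Require Import all_classical.
From mathcomp Require Import generic_quotient zify.

Set Implicit Arguments.
Unset Strict Implicit.
Unset Printing Implicit Defensive.

Import Order.TTheory.
Local Open Scope order_scope.
Local Open Scope group_scope.
Local Open Scope classical_set_scope.
Local Open Scope card_scope.

(** Two independent facts are composed.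

    Regular covers.  Let Q be a polyhedron whose monodromy group G is a string
    C-group.  The cosets of the three parabolic subgroups of G, ordered by
    incidence, form a regular polyhedron R ([coset_regular_polyhedron]) that
    covers Q and is covered by every regular polyhedron covering Q, so a minimal
    regular cover P of Q is isomorphic to R.  The flags of R are the elements of
    G, and the i-adjacent flag is obtained by multiplying by the i-th generator
    on the right.  An automorphism commutes with these right multiplications, so
    it is a left translation; hence Aut P is G, generator to generator
    ([cayley_iso], [minimal_cover_aut]).

    The presentation.  Number the vertices of the antiprism by Z/2n with
    u_i = 2i and v_i = 2i - 1.  Edges join numbers at distance 1 or 2, triangles
    are three consecutive numbers, and the n-gons are the two parity classes.
    A flag is a vertex x, a direction e = 1 or -1 and one of four types:
    A: the edge {x, x+2e} in an n-gon;  B: the same edge in its triangle;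
    C: the edge {x, x+e} in the triangle centred at x+e;
    D: the edge {x, x+e} in the triangle centred at x.
    The generators a, b, c act on the types as (C D), (B C), (A B)(C D), which
    already separates the parabolic subgroups ([antiprism_mon_C_group]).  The
    element t = (ab)^3 moves a flag of type A by three steps along its n-gon and
    fixes all other flags; its conjugates tA = t, tB, tC, tD do the same for the
    four types.

    In any group with the given relations, the extra relation amounts to
    c tC c = tD^-1.  Combined with (bc)^4 = 1 it gives b tD b = tD^-1, which is
    the commutation of t with c t c, and then all four elements commute and span
    a normal subgroup N.  Modulo N the group is a quotient of the octahedral
    group [3,4], so every element is a product of powers of tA, tB, tC, tD and of
    one of 48 words ([normal_form]).  An element that fixes every flag fixes the
    types and the orientation of the antiprism; among the 48 words only the
    empty one does ([trivial_coset_word]).  What remains moves flags of type A by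
    6i numbers, so n divides 3i, and the power of t is trivial since t has order
    dividing lcm(3,n)/3.  Thus the presented group acts faithfully on the flags
    ([trivial_run_normal_form]), that is, it is the monodromy group. *)

(** * Flags of a ranked poset *)

(** A parametrization of the flags of a rank 3 poset by [X]: [face x k] is the
    face of rank k - 1 of the flag x, and [nb i x] is its i-adjacent flag.  Only
    pairs and triples of incident faces have to be completed to flags, because a
    chain has at most one face of each of the ranks 0, 1, 2.  Stating everything
    through [face] lets the antiprism and the coset posets share the results, and
    makes the structure trivial to transport along an isomorphism. *)
Record flag_system d (P : tbPOrderType d) (X : Type)
    (face : X -> nat -> P) (nb : 'I_3 -> X -> X) : Prop := FlagSystem {
  fs_cover : forall z, exists x k, (k < 5)%N /\ z = face x k;
  fs_chain : forall x k l, (k <= l)%N -> (l < 5)%N -> face x k <= face x l;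
  fs_rank : forall x y k l, (k < 5)%N -> (l < 5)%N ->
    face x k <= face y l -> (k <= l)%N;
  fs_level : forall x y k, (k < 5)%N ->
    face x k <= face y k -> face x k = face y k;
  fs_pair : forall x y k l, (0 < k < l)%N -> (l < 4)%N ->
    face x k <= face y l ->
    exists z, face z k = face x k /\ face z l = face y l;
  fs_triple : forall x y w, face x 1%N <= face y 2%N ->
    face y 2%N <= face w 3%N ->
    exists z, [/\ face z 1%N = face x 1%N, face z 2%N = face y 2%N
      & face z 3%N = face w 3%N];
  fs_inj : forall x y, (forall k, (k < 5)%N -> face x k = face y k) -> x = y;
  fs_nb : forall (i : 'I_3) x y,
    (x <> y /\ forall k, (k < 5)%N -> k <> i.+1 -> face x k = face y k) <->
    y = nb i x
}.

Lemma card_pair T (x y : T) : x <> y -> [set x; y] #= `I_2.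
Proof.
move=> xy.
rewrite (_ : [set x; y] = [set (if k == 0%N then x else y) | k in `I_2]).
  by apply: inj_card_eq => -[|[|k]] [|[|l]] /set_mem + /set_mem //= => _ _ // /esym.
apply/seteqP; split=> z /=.
  by case=> ->; [exists 0%N | exists 1%N].
by case=> -[|[|k]] //= _ <-; [left | right].
Qed.

Section FlagSystem.
Variables (d : Order.disp_t) (P : tbPOrderType d) (X : Type).
Variables (face : X -> nat -> P) (nb : 'I_3 -> X -> X).
Hypothesis fs : flag_system face nb.

Definition flag_faces (x : X) : set P := [set face x k | k in `I_5].

Lemma face_rank_eq x y k l : (k < 5)%N -> (l < 5)%N ->
  face x k = face y l -> k = l.
Proof.
move=> k5 l5 e; apply/eqP; rewrite eqn_leq.
by rewrite (fs_rank fs k5 l5 (y := y) (x := x)) ?e //= (fs_rank fs l5 k5 (x := y) (y := x)) ?e.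
Qed.

Lemma face_bot x : face x 0%N = \bot.
Proof.
have [y [k [k5 e]]] := fs_cover fs \bot.
have le0 : face y k <= face x 0%N by rewrite -e le0x.
have := fs_rank fs k5 _ le0; rewrite leqn0 => /(_ isT)/eqP k0.
by rewrite e; move: le0; rewrite k0 => /(fs_level fs (k := 0) isT).
Qed.

Lemma face_top x : face x 4%N = \top.
Proof.
have [y [k [k5 e]]] := fs_cover fs \top.
have le4 : face x 4%N <= face y k by rewrite -e lex1.
have k4 := fs_rank fs (isT : (4 < 5)%N) k5 le4.
have {}k4 : k = 4%N by apply/eqP; rewrite eqn_leq k4 andbT.
by rewrite e; move: le4; rewrite k4 => /(fs_level fs (k := 4) isT).
Qed.

Lemma face_pair x y k l : (k <= l)%N -> (l < 5)%N -> face x k <= face y l ->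
  exists z, face z k = face x k /\ face z l = face y l.
Proof.
move=> kl l5 le; have [k0|k0] := posnP k.
  by exists y; split=> //; rewrite k0 !face_bot.
have [l4|l4] := leqP 4 l.
  have -> : l = 4%N by apply/eqP; rewrite eqn_leq l4 andbT.
  by exists x; rewrite !face_top.
have [kl' | lk] := ltnP k l; first by apply: (fs_pair fs) => //; rewrite k0.
have {lk}e : k = l by apply/eqP; rewrite eqn_leq kl.
by exists x; subst l; split=> //; apply: (fs_level fs).
Qed.

Lemma faces_total x : total_on (flag_faces x) (fun u v => u <= v).
Proof.
move=> _ _ [k k5 <-] [l l5 <-].
by case/orP: (leq_total k l) => kl; [left|right]; apply: (fs_chain fs).
Qed.

Lemma level_comparable x y k : (k < 5)%N ->
  face x k <= face y k \/ face y k <= face x k -> face x k = face y k.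
Proof. by move=> k5 [/(fs_level fs k5)|/(fs_level fs k5)->]. Qed.

Lemma faces_flag x : is_flag (flag_faces x).
Proof.
split; first exact: faces_total.
move=> B totB sub z Bz; have [y [k [k5 e]]] := fs_cover fs z.
exists k => //; rewrite e; apply: level_comparable => //; rewrite -e.
by apply: totB => //; apply: sub; exists k.
Qed.

Definition flag_of (x : X) : flag P := Sub (flag_faces x) (asboolT (faces_flag x)).

Lemma flag_inj (Psi Psi' : flag P) : (Psi : set P) = Psi' -> Psi = Psi'.
Proof. exact: val_inj. Qed.

(** The one place where the completion of pairs and triples is used: a chain is
    determined by its faces of ranks 0, 1, 2, some of which may be absent, and
    in each of the eight cases some flag passes through those present. *)
Lemma chain_in_flag (A : set P) : total_on A (fun u v => u <= v) ->
  exists z, A `<=` flag_faces z.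
Proof.
move=> totA.
pose has k x := A (face x k).
have hasP k : (exists x, has k x) \/ forall x, ~ has k x.
  by have [h|h] := pselect (exists x, has k x); [left|right=> x hx; apply: h; exists x].
have cmp k l x y : (k < l < 5)%N -> has k x -> has l y -> face x k <= face y l.
  case/andP=> kl l5 hx hy; have [//|le] := totA _ _ hx hy.
  have := fs_rank fs l5 (ltn_trans kl l5) le.
  by rewrite leqNgt kl.
have agree k x z : (k < 5)%N -> has k x -> face z k = face x k ->
    forall y, has k y -> face y k = face z k.
  move=> k5 hx -> y hy; apply: level_comparable => //; exact: totA.
suff [z hz] : exists z, forall k y, (0 < k < 4)%N -> has k y -> face y k = face z k.
  exists z => u Au; have [y [k [k5 e]]] := fs_cover fs u.
  exists k => //; rewrite e; have [->|k0] := posnP k; first by rewrite !face_bot.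
  have [k4|k4] := ltnP k 4; first by apply/esym/hz; rewrite ?k0 // /has -e.
  have -> : k = 4%N by apply/eqP; rewrite eqn_leq k4 andbT.
  by rewrite !face_top.
have [x0 _] := fs_cover fs \bot.
have fin z : (forall y, has 1%N y -> face y 1%N = face z 1%N) ->
  (forall y, has 2%N y -> face y 2%N = face z 2%N) ->
  (forall y, has 3%N y -> face y 3%N = face z 3%N) ->
  exists z, forall k y, (0 < k < 4)%N -> has k y -> face y k = face z k.
  by move=> h1 h2 h3; exists z => -[|[|[|[|k]]]] y // _; [exact: h1|exact: h2|exact: h3].
have [[x1 h1]|n1] := hasP 1%N; have [[x2 h2]|n2] := hasP 2%N;
  have [[x3 h3]|n3] := hasP 3%N.
- have [z [e1 e2 e3]] := fs_triple fs (cmp 1%N 2%N _ _ isT h1 h2) (cmp 2%N 3%N _ _ isT h2 h3).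
  by apply: (fin z); [exact: (agree 1%N _ _ isT h1 e1)|exact: (agree 2%N _ _ isT h2 e2)|exact: (agree 3%N _ _ isT h3 e3)].
- have [z [e1 e2]] := face_pair (isT : (1 <= 2)%N) isT (cmp 1%N 2%N _ _ isT h1 h2).
  by apply: (fin z); [exact: (agree 1%N _ _ isT h1 e1)|exact: (agree 2%N _ _ isT h2 e2)|move=> y /n3].
- have [z [e1 e2]] := face_pair (isT : (1 <= 3)%N) isT (cmp 1%N 3%N _ _ isT h1 h3).
  by apply: (fin z); [exact: (agree 1%N _ _ isT h1 e1)|move=> y /n2|exact: (agree 3%N _ _ isT h3 e2)].
- by apply: (fin x1); [exact: (agree 1%N _ _ isT h1 erefl)|move=> y /n2|move=> y /n3].
- have [z [e1 e2]] := face_pair (isT : (2 <= 3)%N) isT (cmp 2%N 3%N _ _ isT h2 h3).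
  by apply: (fin z); [move=> y /n1|exact: (agree 2%N _ _ isT h2 e1)|exact: (agree 3%N _ _ isT h3 e2)].
- by apply: (fin x2); [move=> y /n1|exact: (agree 2%N _ _ isT h2 erefl)|move=> y /n3].
- by apply: (fin x3); [move=> y /n1|move=> y /n2|exact: (agree 3%N _ _ isT h3 erefl)].
- by apply: (fin x0); [move=> y /n1|move=> y /n2|move=> y /n3].
Qed.

Lemma flag_ofP (Psi : flag P) : exists x, Psi = flag_of x.
Proof.
have [tot mx] := asboolW (valP Psi); have [z sub] := chain_in_flag tot.
exists z; apply: flag_inj; apply/seteqP; split=> //=.
exact: (mx _ (@faces_total z) sub).
Qed.

Lemma face_flag x k : (k < 5)%N -> (flag_of x : set P) (face x k).
Proof. by exists k. Qed.

Lemma in_flag_of x y k : (k < 5)%N -> (flag_of x : set P) (face y k) -> face y k = face x k.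
Proof. by move=> k5 [l l5 e]; rewrite -e (face_rank_eq l5 k5 e). Qed.

Lemma faces_card x m : (m <= 5)%N -> [set face x k | k in `I_m] #= `I_m.
Proof.
move=> m5; apply: inj_card_eq => k l /set_mem/= km /set_mem/= lm.
by apply: face_rank_eq; [apply: leq_trans m5|apply: leq_trans m5].
Qed.

Lemma flag_of_inj : injective flag_of.
Proof.
move=> x y e; apply: (fs_inj fs) => k k5; apply: in_flag_of => //.
by rewrite -e; apply: face_flag.
Qed.

Lemma face_lt x y k l : (k < 5)%N -> (l < 5)%N -> face x k < face y l -> (k < l)%N.
Proof.
move=> k5 l5; rewrite lt_neqAle => /andP[ne le].
rewrite ltn_neqAle (fs_rank fs k5 l5 le) andbT.
by apply: contra ne => /eqP kl; subst l; apply/eqP/(fs_level fs).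
Qed.

Lemma face_ltE x k l : (k < l)%N -> (l < 5)%N -> face x k < face x l.
Proof.
move=> kl l5; rewrite lt_neqAle (fs_chain fs) ?(ltnW kl) // andbT.
apply/eqP => /(face_rank_eq (ltn_trans kl l5) l5) e.
by rewrite e ltnn in kl.
Qed.

(** Ranks are intrinsic although they are counted along a flag: below [face z k]
    the flag z has exactly the faces of index less than k. *)
Lemma has_rank_face x k r : (k < 5)%N -> has_rank (face x k) r <-> r = (k%:Z - 1)%R.
Proof.
move=> k5.
have cardlt z : [set y | (flag_of z : set P) y /\ y < face z k] #= `I_k.
  rewrite (_ : [set _ | _] = [set face z l | l in `I_k]).
    by apply: faces_card; apply: ltnW.
  apply/seteqP; split=> y /=.
    by move=> [[l l5 <-] lt]; exists l => //; exact: face_lt lt.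
  move=> [l lk <-]; split; last exact: face_ltE.
  by apply: face_flag; apply: leq_trans k5; apply: ltnW.
split=> [[Psi [m [Px cm ->]]]|->].
  have [z e] := flag_ofP Psi; move: Px cm; rewrite {}e => Px.
  rewrite (in_flag_of k5 Px) => cm.
  have /card_eq_II -> // : `I_m #= `I_k.
  by apply: card_eq_trans (cardlt z); apply: card_esym.
by exists (flag_of x), k; split=> //; apply: face_flag.
Qed.

Lemma adjacentE i x y : adjacent i (flag_of x) (flag_of y) <-> y = nb i x.
Proof.
rewrite -(fs_nb fs); split=> [[ne h]|[ne h]]; split.
- by move=> e; apply: ne; rewrite e.
- move=> k k5 ki; apply: in_flag_of => //; apply/h; last exact: face_flag.
  move=> /(has_rank_face _ _ k5) e; apply: ki.
  by move: e; move: (nat_of_ord i) => j; lia.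
- by move=> /flag_of_inj.
- move=> z; have [w [k [k5 ->]]] := fs_cover fs z => nr.
  have ki : k <> i.+1.
    move=> ki; apply: nr; apply/(has_rank_face _ _ k5); rewrite ki.
    by move: (nat_of_ord i) => j; lia.
  have e := h k k5 ki; split=> /(in_flag_of k5) ->; rewrite ?e; last rewrite -e.
    exact: face_flag.
  exact: face_flag.
Qed.

Lemma nb_adjacent i x : adjacent i (flag_of x) (flag_of (nb i x)).
Proof. exact/adjacentE. Qed.

Lemma monodromyE i (r : Sym (flag P)) : is_monodromy i r ->
  forall x, r (flag_of x) = flag_of (nb i x).
Proof.
move=> rm x; have := rm (flag_of x); have [y ->] := flag_ofP (r (flag_of x)).
by move/adjacentE=> ->.
Qed.

Lemma monodromyP i (r : Sym (flag P)) :
  (forall x, r (flag_of x) = flag_of (nb i x)) -> is_monodromy i r.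
Proof.
by move=> h Psi; have [x ->] := flag_ofP Psi; rewrite h; apply/adjacentE.
Qed.

Lemma monodromy_unique i (r r' : Sym (flag P)) :
  is_monodromy i r -> is_monodromy i r' -> r = r'.
Proof.
move=> rm rm'; apply: symP => Psi; have [x ->] := flag_ofP Psi.
by rewrite !(monodromyE (i := i)).
Qed.

Lemma nb_face (i : 'I_3) x k : (k < 5)%N -> k <> i.+1 -> face (nb i x) k = face x k.
Proof. by have [_ /(_ erefl)[_ h]] := fs_nb fs i x (nb i x) => k5 ki; rewrite h. Qed.

Lemma nb_face_neq (i : 'I_3) x : face (nb i x) i.+1 <> face x i.+1.
Proof.
have [_ /(_ erefl)[ne _]] := fs_nb fs i x (nb i x) => e; apply: ne.
apply: (fs_inj fs) => k k5; have [->|/eqP ki] := eqVneq k i.+1; first by rewrite e.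
by rewrite nb_face.
Qed.

(** The diamond condition in terms of flags: leaving rank i free determines a
    flag up to i-adjacency. *)
Lemma agree_nb (i : 'I_3) x w :
  (forall k, (0 < k < 4)%N -> k <> i.+1 -> face w k = face x k) ->
  face w i.+1 = face x i.+1 \/ face w i.+1 = face (nb i x) i.+1.
Proof.
move=> h; have [->|ne] := pselect (w = x); first by left.
right; congr (face _ _); apply/(fs_nb fs); split=> [e|k k5 ki]; first exact: ne.
have [->|k0] := posnP k; first by rewrite !face_bot.
have [k4|k4] := ltnP k 4; first by rewrite h // k0.
have -> : k = 4%N by apply/eqP; rewrite eqn_leq k4 andbT.
by rewrite !face_top.
Qed.

Lemma comparable_face x y k l : (k < l)%N -> (l < 5)%N ->
  face x k >=< face y l -> face x k <= face y l.
Proof.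
move=> kl l5 /orP[//|le]; have := fs_rank fs l5 (ltn_trans kl l5) le.
by rewrite leqNgt kl.
Qed.

Lemma ranked x r : has_rank x r -> exists y k, [/\ (k < 5)%N, x = face y k & r = (k%:Z - 1)%R].
Proof.
have [y [k [k5 ->]]] := fs_cover fs x => /(has_rank_face _ _ k5) e.
by exists y, k.
Qed.

Lemma ranked_face x (i : nat) : (i < 3)%N -> has_rank x i%:Z -> exists y, x = face y i.+1.
Proof.
move=> i3 /ranked[y [k [k5 -> e]]]; exists y; congr (face _ _); lia.
Qed.

Lemma has_rankS x (i : nat) : (i < 3)%N -> has_rank (face x i.+1) i%:Z.
Proof. by move=> i3; apply/has_rank_face; [lia|lia]. Qed.

Lemma diamond (i : 'I_3) x (A : set P) :
  (forall y, A y -> exists w, y = face w i.+1 /\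
     forall k, (0 < k < 4)%N -> k <> i.+1 -> face w k = face x k) ->
  A (face x i.+1) -> A (face (nb i x) i.+1) -> A #= `I_2.
Proof.
move=> h Ax Anb.
rewrite (_ : A = [set face x i.+1; face (nb i x) i.+1]).
  by apply: card_pair => e; apply: (@nb_face_neq i x).
apply/seteqP; split=> y; last by case=> ->.
by move=> /h[w [-> /agree_nb]].
Qed.

(** All axioms except strong connectivity come from the parametrization: each
    diamond condition frees one rank of a flag, and [diamond] counts the two
    choices. *)
Lemma flag_system_polyhedron :
  (forall F G : P, F <= G -> connected_section F G) -> is_polyhedron P.
Proof.
move=> conn; split=> //.
- move=> Psi; have [x ->] := flag_ofP Psi; split.
  + by rewrite -(face_bot x); apply: face_flag.
  + by rewrite -(face_top x); apply: face_flag.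
  + exact: faces_card.
- move=> _ /(ranked_face (i := 1) isT)[x ->]; split.
  + apply: (@diamond (@Ordinal 3 0 isT) x) => /=.
    * move=> _ [/(ranked_face (i := 0) isT)[y ->]].
      move/(comparable_face (k := 1) (l := 2) isT isT) => le.
      have [w [e1 e2 e3]] := fs_triple fs le (fs_chain fs x (leqnSn 2) isT).
      by exists w; split=> // -[|[|[|[|k]]]].
    * split; first exact: has_rankS.
      by apply/orP; left; apply: (fs_chain fs).
    * split; first exact: has_rankS.
      apply/orP; left; rewrite -(@nb_face (@Ordinal 3 0 isT) x 2) //.
      exact: (fs_chain fs).
  + apply: (@diamond (@Ordinal 3 2 isT) x) => /=.
    * move=> _ [/(ranked_face (i := 2) isT)[y ->]].
      rewrite comparable_sym => /(comparable_face (k := 2) (l := 3) isT isT) le.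
      have [w [e1 e2 e3]] := fs_triple fs (fs_chain fs x (leqnSn 1) isT) le.
      by exists w; split=> // -[|[|[|[|k]]]].
    * split; first exact: has_rankS.
      by apply/orP; right; apply: (fs_chain fs).
    * split; first exact: has_rankS.
      apply/orP; right; rewrite -(@nb_face (@Ordinal 3 2 isT) x 2) //.
      exact: (fs_chain fs).
- move=> _ _ /(ranked_face (i := 0) isT)[v ->] /(ranked_face (i := 2) isT)[f ->].
  move=> /(comparable_face (k := 1) (l := 3) isT isT) le.
  have [x [<- <-]] := face_pair (isT : (1 <= 3)%N) isT le.
  apply: (@diamond (@Ordinal 3 1 isT) x) => /=.
  + move=> _ [/(ranked_face (i := 1) isT)[y ->]].
    rewrite comparable_sym => /(comparable_face (k := 1) (l := 2) isT isT) le1.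
    move=> /(comparable_face (k := 2) (l := 3) isT isT) le2.
    have [w [e1 e2 e3]] := fs_triple fs le1 le2.
    by exists w; split=> // -[|[|[|[|k]]]].
  + split; first exact: has_rankS.
      by apply/orP; right; apply: (fs_chain fs).
    by apply/orP; left; apply: (fs_chain fs).
  + split; first exact: has_rankS.
      apply/orP; right; rewrite -(@nb_face (@Ordinal 3 1 isT) x 1) //.
      exact: (fs_chain fs).
    apply/orP; left; rewrite -(@nb_face (@Ordinal 3 1 isT) x 3) //.
    exact: (fs_chain fs).
Qed.

End FlagSystem.

(** * Posets whose flags are the elements of a group *)
Lemma generated_ind (G : groupType) (S : set G) (H : G -> Prop) :
  H 1 -> (forall x y, H x -> H y -> H (x / y)) -> (forall s, S s -> H s) ->
  forall g, generated S g -> H g.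
Proof.
move=> H1 HD HS g; apply; split=> [|s /HS //].
split; first by rewrite in_setE.
by move=> x y; rewrite !in_setE; apply: HD.
Qed.

Section Generated.
Variables (G : groupType) (S : set G).

Lemma generated1 : generated S 1.
Proof. by have /asboolP := (generated_group_closed S).1. Qed.

Lemma generatedD x y : generated S x -> generated S y -> generated S (x / y).
Proof.
move=> /asboolT xS /asboolT yS.
by have /asboolP := (generated_group_closed S).2 x y xS yS.
Qed.

Lemma generatedV x : generated S x -> generated S x^-1.
Proof. by move/(generatedD generated1); rewrite div1g. Qed.

Lemma generatedM x y : generated S x -> generated S y -> generated S (x * y).
Proof. by move=> xS /generatedV yS; rewrite -(invgK y); apply: generatedD. Qed.

Lemma generated_mem x : S x -> generated S x.
Proof. exact: sub_gen_smallest. Qed.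
End Generated.

Lemma aut_mono d (P : tbPOrderType d) (s : Aut P) : {mono s : x y / x <= y}.
Proof. exact: asboolW (valP s). Qed.

Lemma aut_ext d (P : tbPOrderType d) (s t : Aut P) : s =1 t -> s = t.
Proof. by move=> st; apply/val_inj/symP. Qed.

Lemma autM d (P : tbPOrderType d) (s t : Aut P) x : (s * t : Aut P) x = t (s x).
Proof. by []. Qed.

Lemma aut_inj d (P : tbPOrderType d) (s : Aut P) : injective s.
Proof. by apply: bij_inj; exact: sym_bij. Qed.

(** The flags of such a poset form the Cayley graph of G for the generators
    [rho]: adjacency is right multiplication, and left multiplication preserves
    the order. *)
Section Cayley.
Variables (d : Order.disp_t) (P : tbPOrderType d) (G : groupType).
Variables (face : G -> nat -> P) (rho : 'I_3 -> G).

Record cayley_system : Prop := CayleySystem {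
  cs_flags : flag_system face (fun i g => g * rho i);
  cs_gen : forall g, generated (range rho) g;
  cs_left : forall u g h k l, (k < 5)%N -> (l < 5)%N ->
    face g k <= face h l -> face (u * g) k <= face (u * h) l
}.

Hypothesis cs : cayley_system.
Let fs := cs_flags cs.

Lemma face_left u g h k : (k < 5)%N -> face g k = face h k ->
  face (u * g) k = face (u * h) k.
Proof.
by move=> k5 e; apply/le_anti; rewrite !(cs_left cs) ?e.
Qed.

Lemma rho_invol i : rho i * rho i = 1.
Proof.
have [_ /(_ erefl)[ne h]] := fs_nb fs i 1 (1 * rho i).
have : 1 = 1 * rho i * rho i.
  by apply/(fs_nb fs); split=> [/esym//|k k5 ki]; rewrite h.
by rewrite mul1g.
Qed.

Lemma rhoV i : (rho i)^-1 = rho i.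
Proof. exact: mulg1_eq (rho_invol i). Qed.

(** Left multiplication acts on faces, and not only on flags, because invariance
    of the order makes [face (u * g) k] depend on [face g k] alone. *)
Lemma translation_ex u :
  exists s : Aut P, forall g k, (k < 5)%N -> s (face g k) = face (u * g) k.
Proof.
pose rep z := sval (cid (fs_cover fs z)).
pose rk z := sval (cid (svalP (cid (fs_cover fs z)))).
have repP z : (rk z < 5)%N /\ z = face (rep z) (rk z).
  exact: (svalP (cid (svalP (cid (fs_cover fs z))))).
pose L u z := face (u * rep z) (rk z).
have LE v g k : (k < 5)%N -> L v (face g k) = face (v * g) k.
  move=> k5; rewrite /L; have [r5 e] := repP (face g k).
  have e' := face_rank_eq fs k5 r5 e.
  by rewrite -e'; apply: face_left => //; rewrite {2}e -e'.
have LK v : cancel (L v) (L v^-1).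
  move=> z; have [r5 ->] := repP z.
  by rewrite !LE // mulKg.
have LK' v : cancel (L v^-1) (L v).
  move=> z; have [r5 ->] := repP z.
  by rewrite !LE // mulVKg.
have Lhomo v z w : z <= w -> L v z <= L v w.
  have [r5 ->] := repP z; have [s5 ->] := repP w.
  by rewrite !LE // => le; apply: (cs_left cs).
pose s : Sym P := Sub (L u) (asboolT (Bijective (LK u) (LK' u))).
have smono : is_aut s.
  apply/asboolP => z w; apply/idP/idP; last exact: Lhomo.
  by move=> /(Lhomo u^-1); rewrite !LK.
by exists (Sub s smono) => g k k5; apply: LE.
Qed.

Definition translation u : Aut P := sval (cid (translation_ex u)).

Lemma translationE u g k : (k < 5)%N -> translation u (face g k) = face (u * g) k.
Proof. by move=> k5; apply: (svalP (cid (translation_ex u))). Qed.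

Lemma translation_inj : injective translation.
Proof.
move=> u v e; rewrite -[u]mulg1 -[v]mulg1; apply: (fs_inj fs) => k k5.
by rewrite -!translationE // e.
Qed.

Lemma translation_flag u x :
  (translation u : P -> P) @` flag_of fs x = flag_of fs (u * x).
Proof.
apply/seteqP; split=> z /=.
  by move=> [w [k k5 <-] <-]; rewrite translationE //; exists k.
by move=> [k k5 <-]; exists (face x k); rewrite ?translationE //; exists k.
Qed.

(** An automorphism preserves ranks: along a flag the indices of the images
    increase strictly within 0, ..., 4. *)
Lemma aut_face (s : Aut P) g :
  exists h, forall k, (k < 5)%N -> s (face g k) = face h k.
Proof.
have tot : total_on [set s (face g k) | k in `I_5] (fun u v => u <= v).
  move=> _ _ [k k5 <-] [l l5 <-]; rewrite !aut_mono.
  by case/orP: (leq_total k l) => kl; [left|right]; apply: (fs_chain fs).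
have [h sub] := chain_in_flag fs tot; exists h.
have /choice[f fP] : forall k, exists l, (k < 5)%N -> (l < 5)%N /\ face h l = s (face g k).
  move=> k; have [k5|_] := ltnP k 5; last by exists 0%N.
  have [|l l5 e] := sub (s (face g k)); first by exists k.
  by exists l.
have fmono k : (k.+1 < 5)%N -> (f k < f k.+1)%N.
  move=> k5; have [l5 e] := fP _ k5; have [l5' e'] := fP _ (ltnW k5).
  apply: (face_lt fs (x := h) (y := h)) => //; rewrite e e'.
  rewrite lt_neqAle aut_mono (fs_chain fs) ?leqnSn // andbT.
  by apply/eqP => /aut_inj/(face_rank_eq fs (ltnW k5) k5); lia.
have f0 := fmono 0%N isT; have f1 := fmono 1%N isT; have f2 := fmono 2%N isT.
have f3 := fmono 3%N isT; have [f4 _] := fP 4%N isT.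
move=> k k5; have [_ <-] := fP k k5; congr (face h _).
by move: k k5 => [|[|[|[|[|k]]]]] //; lia.
Qed.

(** Rigidity: an automorphism commutes with passing to adjacent flags, that is
    with right multiplication by the generators, hence is the left multiplication
    by the image of 1. *)
Lemma aut_translation (s : Aut P) : exists u, s = translation u.
Proof.
have [f fP] := choice (aut_face s).
have fM g : f g = f 1 * g.
  suff H w : generated (range rho) w -> forall g, f (g * w) = f g * w.
    by have := H g (cs_gen cs g) 1; rewrite mul1g.
  move: w; apply: generated_ind => [g'|x y Hx Hy g'|_ [i _ <-] g'].
  - by rewrite !mulg1.
  - apply: (mulIg y); rewrite -Hy -!mulgA mulVg !mulg1.
    by rewrite Hx.
  - apply/(fs_nb fs); have [_ /(_ erefl)[ne h]] := fs_nb fs i g' (g' * rho i).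
    split=> [e|k k5 ki]; last by rewrite -!fP // h.
    apply: ne; apply: (fs_inj fs) => k k5; apply: (@aut_inj _ _ s).
    by rewrite !fP // e.
exists (f 1); apply: aut_ext => z; have [x [k [k5 ->]]] := fs_cover fs z.
by rewrite fP // translationE // fM.
Qed.

Lemma cayley_regular : is_regular P.
Proof.
move=> Phi Psi; have [x ->] := flag_ofP fs Phi; have [y ->] := flag_ofP fs Psi.
by exists (translation (y / x)); rewrite translation_flag divgK.
Qed.

(** Automorphisms compose from left to right, so [translation] is an
    antimorphism; the inverse corrects this, and conjugation by x turns the
    generators into the distinguished generators at the flag x. *)
Definition cayley_map x g : Aut P := translation (x / g / x).

Lemma cayley_mapM x : {morph cayley_map x : g h / g * h}.
Proof.
move=> g h; apply: aut_ext => z; have [y [k [k5 ->]]] := fs_cover fs z.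
rewrite autM !translationE // invgM !mulgA.
by rewrite mulgVK.
Qed.
HB.instance Definition _ x := isMultiplicative.Build G (Aut P) (cayley_map x) (cayley_mapM x).

Lemma cayley_map_bij x : bijective (cayley_map x).
Proof.
pose inv (s : Aut P) := (x^-1 * sval (cid (aut_translation s)) * x)^-1.
have invP s : cayley_map x (inv s) = s.
  rewrite {2}(svalP (cid (aut_translation s))) /cayley_map /inv.
  by rewrite invgK !mulgA divgg mul1g mulgK.
exists inv => // g; have := invP (cayley_map x g).
by move/translation_inj/mulIg/mulgI/invg_inj.
Qed.

Lemma cayley_map_distinguished x : distinguished (flag_of fs x) (cayley_map x \o rho).
Proof.
move=> i; exists (flag_of fs (x * rho i)); first exact: nb_adjacent.
by rewrite /= translation_flag divgK rhoV.
Qed.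

Lemma distinguished_cayley_map x rho' :
  distinguished (flag_of fs x) rho' -> forall i, rho' i = cayley_map x (rho i).
Proof.
move=> dist i; have [Psi adj im] := dist i.
have [u e] := aut_translation (rho' i); rewrite e; congr translation.
apply: (mulIg x); rewrite divgK rhoV; apply/(adjacentE fs).
suff -> : flag_of fs (u * x) = Psi by [].
by apply: flag_inj; rewrite -im e translation_flag.
Qed.

Theorem cayley_iso (Phi : flag P) (rho' : 'I_3 -> Aut P) :
  distinguished Phi rho' ->
  exists f : {multiplicative G -> Aut P}, bijective f /\ forall i, f (rho i) = rho' i.
Proof.
have [x ->] := flag_ofP fs Phi => dist.
exists (cayley_map x); split; first exact: cayley_map_bij.
by move=> i; rewrite (distinguished_cayley_map dist).
Qed.

Let moni_fun g (Psi : flag P) := flag_of fs (sval (cid (flag_ofP fs Psi)) * g).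
Let moni_funE g x : moni_fun g (flag_of fs x) = flag_of fs (x * g).
Proof.
by rewrite /moni_fun -(flag_of_inj (svalP (cid (flag_ofP fs (flag_of fs x))))).
Qed.

(** Right multiplication acts on flags, so G maps to the monodromy group. *)
Lemma cayley_mon_ex : exists f : {multiplicative G -> Mon P},
  forall i, is_monodromy i (mon_fun (f (rho i))).
Proof.
have K g : cancel (moni_fun g) (moni_fun g^-1).
  by move=> Psi; have [x ->] := flag_ofP fs Psi; rewrite !moni_funE mulgK.
have K' g : cancel (moni_fun g^-1) (moni_fun g).
  by move=> Psi; have [x ->] := flag_ofP fs Psi; rewrite !moni_funE mulgVK.
pose m g : Sym (flag P) := Sub (moni_fun g) (asboolT (Bijective (K g) (K' g))).
have mE g x : m g (flag_of fs x) = flag_of fs (x * g) by apply: moni_funE.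
have mM : {morph m : g h / g * h}.
  move=> g h; apply: symP => Psi; have [x ->] := flag_ofP fs Psi.
  by rewrite /= mE -[RHS]/(m h (m g (flag_of fs x))) !mE mulgA.
have m1 : m 1 = 1.
  by apply: (mulgI (m 1)); rewrite -mM !mulg1.
have mV g : m g^-1 = (m g)^-1.
  by apply: (mulgI (m g)); rewrite -mM !mulgV.
have mmon i : is_monodromy i (m (rho i)).
  by apply: (monodromyP (fs := fs)) => x; rewrite mE.
have mgen g : `[< generated [set r | exists i, is_monodromy i r] (m g) >].
  apply/asboolP; have := cs_gen cs g.
  move: g; apply: generated_ind => [|x y hx hy|_ [i _ <-]].
  - by rewrite m1; apply: generated1.
  - by rewrite mM mV; apply: generatedD.
  - by apply: generated_mem; exists i.
pose f g : Mon P := Sub (m g) (mgen g).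
have fM : {morph f : g h / g * h} by move=> g h; apply: val_inj; rewrite gmulfM /= mM.
pose fm := isMultiplicative.Build G (Mon P) f fM.
pose fh : {multiplicative G -> Mon P} := HB.pack f fm.
by exists fh.
Qed.

End Cayley.

(** * The coset polyhedron of a string C-group *)
Notation i0 := (@Ordinal 3 0 isT).
Notation i1 := (@Ordinal 3 1 isT).
Notation i2 := (@Ordinal 3 2 isT).

Lemma ord3P (i : 'I_3) : [\/ i = i0, i = i1 | i = i2].
Proof.
case: i => -[|[|[|//]]] h.
- by apply: Or31; apply: val_inj.
- by apply: Or32; apply: val_inj.
- by apply: Or33; apply: val_inj.
Qed.

(** Involutive generators make every element a word in them, so induction may
    append one generator at a time. *)
Lemma generated_words (G : groupType) (S : set G) (H : G -> Prop) :
  (forall s, S s -> s * s = 1) ->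
  H 1 -> (forall x s, H x -> S s -> H (x * s)) -> forall g, generated S g -> H g.
Proof.
move=> inv H1 HM g gS.
suff /(_ 1) : forall x, H x <-> H (x * g) by rewrite mul1g => <-.
move: g gS; apply: generated_ind => [x|x y Hx Hy z|s Ss x].
- by rewrite mulg1.
- by rewrite (Hx z) (Hy (z * (x / y))) mulgA divgK.
- split=> [/HM|/HM]; first exact.
  by move=> /(_ _ Ss); rewrite -mulgA inv // mulg1.
Qed.

Section Parabolic.
Variables (G : groupType) (rho : 'I_3 -> G).

(** Generators are omitted by the index k = i + 1 of the rank they change, so
    that k = 0 and k = 4, which omit nothing, give the whole group and serve for
    the least and the greatest face. *)
Definition parabolic (k : nat) : set G :=
  generated [set rho i | i in [set i : 'I_3 | i.+1 <> k]].

(** The intersection property in reduced form: each generator is outside the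
    parabolic subgroup that omits it, and the stabilizers of a vertex and of a
    face meet in the group of order 2 generated by rho_1.  Its other instances
    follow, because the middle parabolic subgroup is the four-group generated by
    rho_0 and rho_2. *)
Record is_string_C_group : Prop := IsStringCGroup {
  sc_invol : forall i, rho i * rho i = 1;
  sc_comm : rho i0 * rho i2 = rho i2 * rho i0;
  sc_gen : forall g, generated (range rho) g;
  sc_indep : forall i : 'I_3, ~ parabolic i.+1 (rho i);
  sc_inter : forall g, parabolic 1 g -> parabolic 3 g -> g = 1 \/ g = rho i1
}.
End Parabolic.

(** Bundled, so that the order on cosets can be inferred from the type of its
    elements. *)
Record string_C_group (G : groupType) := StringCGroup {
  cg_rho :> 'I_3 -> G;
  cg_proof : is_string_C_group cg_rho
}.

Section CosetPoset.
Variables (G : groupType) (C : string_C_group G).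
Local Notation rho := (cg_rho C).
Local Notation par := (parabolic C).
Let pf := cg_proof C.

Lemma par_all k : (forall i : 'I_3, i.+1 <> k) -> forall g, par k g.
Proof.
move=> h g; move: g (sc_gen pf g); apply: generated_ind => [|x y|_ [i _ <-]].
- exact: generated1.
- exact: generatedD.
- by apply: generated_mem; exists i => //=; apply: h.
Qed.

Lemma par0 g : par 0%N g. Proof. exact: par_all. Qed.

Lemma par4 g : par 4%N g.
Proof. by apply: par_all => i; have := ltn_ord i; lia. Qed.

Lemma par_gen (i : 'I_3) k : i.+1 <> k -> par k (rho i).
Proof. by move=> h; apply: generated_mem; exists i. Qed.

(** The edge stabilizer is the product of its intersections with the other two
    parabolic subgroups; this is what makes incidence of cosets transitive. *)
Lemma par2P g : par 2%N g -> exists u v,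
  [/\ g = u * v, g = v * u, u = 1 \/ u = rho i0 & v = 1 \/ v = rho i2].
Proof.
move: g; apply: generated_words.
- by move=> _ [i _ <-]; apply: (sc_invol pf).
- by exists 1, 1; rewrite mulg1; split=> //; left.
- move=> _ _ [u [v [-> e hu hv]]] [i /= ni <-].
  have aa := sc_invol pf i0; have cc := sc_invol pf i2.
  have ac := sc_comm pf.
  have [->|e1|->] := ord3P i; last 1 first.
  + exists u, (v * rho i2); split=> //.
    * by rewrite mulgA.
    * by rewrite e -!mulgA; case: hu => ->; rewrite ?mul1g ?mulg1 // ac.
    * by case: hv => ->; rewrite ?mul1g; [right|left].
  + exists (u * rho i0), v; split=> //.
    * by rewrite -!mulgA; case: hv => ->; rewrite ?mul1g ?mulg1 // ac.
    * by rewrite e mulgA.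
    * by case: hu => ->; rewrite ?mul1g; [right|left].
  + by case: ni; rewrite e1.
Qed.

Definition coset k g : set G := [set x | par k (g^-1 * x)].

Lemma coset_refl k g : coset k g g.
Proof. by rewrite /coset /= mulVg; apply: generated1. Qed.

Lemma coset_eq k g x : coset k g x -> coset k x = coset k g.
Proof.
rewrite /coset /= => gx; apply/seteqP; split=> y /= h.
  by have := generatedM gx h; rewrite mulgA mulgK.
have := generatedM (generatedV gx) h.
by rewrite invgM invgK -mulgA mulVKg.
Qed.

Lemma coset_meet k g h x : coset k g x -> coset k h x -> coset k g = coset k h.
Proof. by move=> /coset_eq <- /coset_eq <-. Qed.

(** The rank is recorded beside the coset since the least and the greatest face
    are the same subset. *)
Definition coset_face : Type :=
  {F : nat * set G | `[< (F.1 < 5)%N /\ exists g, F.2 = coset F.1 g >]}.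
HB.instance Definition _ := SubChoice.on coset_face.

Fact coset_face_subproof k g : (k < 5)%N ->
  `[< ((k, coset k g).1 < 5)%N /\ exists h, (k, coset k g).2 = coset (k, coset k g).1 h >].
Proof. by move=> k5; apply/asboolP; split=> //; exists g. Qed.

Fact min4_lt5 k : (minn k 4 < 5)%N. Proof. lia. Qed.

Fact min4 k : (k < 5)%N -> minn k 4 = k. Proof. lia. Qed.

Definition cface (g : G) (k : nat) : coset_face :=
  Sub (minn k 4, coset (minn k 4) g) (coset_face_subproof g (min4_lt5 k)).

Definition crank (F : coset_face) : nat := (val F).1.
Definition cset (F : coset_face) : set G := (val F).2.

Lemma cface_rank g k : (k < 5)%N -> crank (cface g k) = k.
Proof. by move=> k5; rewrite /crank SubK /= min4. Qed.

Lemma cface_set g k : (k < 5)%N -> cset (cface g k) = coset k g.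
Proof. by move=> k5; rewrite /cset SubK /= min4. Qed.

Lemma cfaceP F : exists g k, (k < 5)%N /\ F = cface g k.
Proof.
have /asboolW [k5 [g e]] := valP F.
exists g, (crank F); split=> //; apply: val_inj => /=.
have -> : minn (crank F) 4 = crank F by apply: min4.
by rewrite /crank -e -surjective_pairing.
Qed.

Definition coset_le (F F' : coset_face) : bool :=
  (crank F <= crank F')%N && `[< exists x, cset F x /\ cset F' x >].

Lemma cface_leP g h k l : (k < 5)%N -> (l < 5)%N ->
  reflect ((k <= l)%N /\ exists x, coset k g x /\ coset l h x)
          (coset_le (cface g k) (cface h l)).
Proof.
move=> k5 l5; rewrite /coset_le !cface_rank // !cface_set //.
by apply: (iffP andP) => -[-> /asboolP].
Qed.

Lemma cface_eq g h k : (k < 5)%N -> coset k g = coset k h -> cface g k = cface h k.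
Proof. by move=> k5 e; apply: val_inj => /=; rewrite min4 // e. Qed.

Lemma cface_eqP g h k : (k < 5)%N -> (cface g k = cface h k) <-> par k (g^-1 * h).
Proof.
move=> k5; split=> [e|h'].
  have : coset k h h by apply: coset_refl.
  by rewrite -(cface_set h k5) -e cface_set.
by apply: cface_eq => //; apply/esym/coset_eq.
Qed.

Fact coset_le_refl : reflexive coset_le.
Proof.
move=> F; have [g [k [k5 ->]]] := cfaceP F; apply/cface_leP => //.
by split=> //; exists g; split; apply: coset_refl.
Qed.

Fact coset_le_anti : antisymmetric coset_le.
Proof.
move=> F F'; have [g [k [k5 ->]]] := cfaceP F; have [h [l [l5 ->]]] := cfaceP F'.
move=> /andP[/cface_leP-/(_ k5 l5)[kl [x [x1 x2]]] /cface_leP-/(_ l5 k5)[lk _]].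
have e : k = l by lia.
by subst l; apply: cface_eq => //; apply: coset_meet x1 x2.
Qed.

(** A vertex and a face incident to a common edge share a flag with it: the two
    incidences differ by an element of the edge stabilizer, which [par2P]
    splits into a part that preserves the face and one that preserves the
    vertex. *)
Lemma coset_le_trans3 g h k : (exists x, coset 1 g x /\ coset 2 h x) ->
  (exists y, coset 2 h y /\ coset 3 k y) ->
  exists z, [/\ coset 1 g z, coset 2 h z & coset 3 k z].
Proof.
move=> [x [gx hx]] [y [hy ky]].
have : par 2%N (x^-1 * y).
  have := generatedM (generatedV hx) hy.
  by rewrite invgM invgK -mulgA mulVKg.
move=> /par2P[u [v [_ e hu hv]]].
have pv : par 1%N v by case: hv => ->; [apply: generated1|apply: par_gen].
have pv2 : par 2%N v by case: hv => ->; [apply: generated1|apply: par_gen].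
have pu : par 3%N u by case: hu => ->; [apply: generated1|apply: par_gen].
have xv : x * v = y / u by rewrite -[y](mulVKg x) e !mulgA mulgK.
exists (x * v); split; rewrite /coset /=; last by rewrite xv mulgA; apply: generatedD.
  by rewrite mulgA; apply: generatedM.
by rewrite mulgA; apply: generatedM.
Qed.

Fact coset_le_trans : transitive coset_le.
Proof.
move=> F2 F1 F3; have [g [i [i5 ->]]] := cfaceP F1.
have [h [j [j5 ->]]] := cfaceP F2; have [l [k [k5 ->]]] := cfaceP F3.
move=> /cface_leP-/(_ i5 j5)[ij [x [x1 x2]]] /cface_leP-/(_ j5 k5)[jk [y [y1 y2]]].
apply/cface_leP => //; split; first exact: leq_trans jk.
have [e|ij'] := eqVneq i j.
  by subst j; exists y; rewrite (coset_meet x1 x2).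
have [e|jk'] := eqVneq j k.
  by subst k; exists x; rewrite -(coset_meet y1 y2).
have [e|i0] := posnP i.
  by exists l; subst i; split; [apply: par0|apply: coset_refl].
have [k4|k4] := leqP 4 k.
  have e : k = 4%N by lia.
  by subst k; exists g; split; [apply: coset_refl|apply: par4].
have [e1 e2 e3] : [/\ i = 1%N, j = 2%N & k = 3%N] by split; lia.
subst i j k; have [z [z1 _ z3]] : exists z, [/\ coset 1 g z, coset 2 h z & coset 3 l z].
  by apply: coset_le_trans3; [exists x|exists y].
by exists z.
Qed.

End CosetPoset.

Fact coset_display : Order.disp_t. Proof. exact: (Order.Disp tt tt). Qed.

Section CosetPolyhedron.
Variables (G : groupType) (C : string_C_group G).
Local Notation rho := (cg_rho C).
Local Notation par := (parabolic C).
Local Notation R := (coset_face C).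
Let pf := cg_proof C.

HB.instance Definition _ := Order.Le_isPOrder.Build coset_display R
  (@coset_le_refl G C) (@coset_le_anti G C) (@coset_le_trans G C).

Fact coset_le0x (F : R) : (cface C 1 0 : R) <= F.
Proof.
have [g [k [k5 ->]]] := cfaceP F; apply/cface_leP => //; split=> //.
by exists g; split; [apply: par0|apply: coset_refl].
Qed.
Fact coset_lex1 (F : R) : F <= (cface C 1 4 : R).
Proof.
have [g [k [k5 ->]]] := cfaceP F; apply/cface_leP => //; split=> //.
by exists g; split; [apply: coset_refl|apply: par4].
Qed.
HB.instance Definition _ := Order.hasBottom.Build _ R coset_le0x.
HB.instance Definition _ := Order.hasTop.Build _ R coset_lex1.

Lemma cface_le g h k l : (k < 5)%N -> (l < 5)%N ->
  cface C g k <= cface C h l <->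
  (k <= l)%N /\ exists x, cface C x k = cface C g k /\ cface C x l = cface C h l.
Proof.
move=> k5 l5; split=> [/cface_leP-/(_ k5 l5)|] [kl [x [x1 x2]]].
  by split=> //; exists x; split; apply: cface_eq => //; apply: coset_eq.
apply/cface_leP => //; split=> //; exists x.
by split; apply/cface_eqP.
Qed.

(** Flags are elements since the stabilizer of a flag, the intersection of the
    three parabolic subgroups, is trivial; adjacency is right multiplication
    since dropping one of them leaves a group of order 2. *)
Lemma coset_flag_system : flag_system (cface C) (fun i g => g * rho i).
Proof.
split.
- exact: cfaceP.
- move=> x k l kl l5; apply/cface_le => //; first exact: leq_ltn_trans l5.
  by split=> //; exists x.
- by move=> x y k l k5 l5 /(cface_le _ _ k5 l5)[].
- by move=> x y k k5 /(cface_le _ _ k5 k5)[_ [z [<- <-]]].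
- move=> x y k l kl l4.
  have k5 : (k < 5)%N by lia.
  have l5 : (l < 5)%N by lia.
  by move=> /(cface_le _ _ k5 l5)[_ [z ?]]; exists z.
- move=> x y w /cface_leP-/(_ isT isT)[_ h1] /cface_leP-/(_ isT isT)[_ h2].
  have [z [z1 z2 z3]] := coset_le_trans3 h1 h2.
  by exists z; split; apply: cface_eq => //; apply: coset_eq.
- move=> x y h; have hp k (k5 : (k < 5)%N) := (cface_eqP C x y k5).1 (h k k5).
  have [/mulg1_eq|e] := sc_inter pf (hp 1%N isT) (hp 3%N isT); first by rewrite invgK.
  by have := sc_indep pf (i := i1); rewrite -e => /(_ (hp 2%N isT)).
move=> i x y; split=> [[ne h]|->]; last first.
  split=> [e|k k5 ki].
    apply: (sc_indep pf (i := i)); have -> : rho i = 1.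
      by apply: (mulgI x); rewrite -e mulg1.
    exact: generated1.
  by apply/cface_eqP => //; rewrite mulKg; apply: par_gen => e; case: ki.
have hp k (k5 : (k < 5)%N) (ki : (k != i.+1)%N) :=
  (cface_eqP C x y k5).1 (h k k5 (elimN eqP ki)).
suff : x^-1 * y = rho i by move=> <-; rewrite mulVKg.
have n1 : x^-1 * y <> 1 by move=> /mulg1_eq; rewrite invgK.
move: hp; have [->|->|->] := ord3P i => hp.
- have [u [v [e e' hu hv]]] := par2P (hp 2%N isT isT).
  case: hv => hv; first by case: hu => hu; rewrite e hv hu ?mulg1 // in n1 *.
  case: (sc_indep pf (i := i2)) => /=; rewrite -hv.
  have -> : v = u^-1 * (x^-1 * y) by rewrite e mulKg.
  apply: generatedM; last exact: hp.
  by apply: generatedV; case: hu => ->; [apply: generated1|apply: par_gen].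
- by have [] := sc_inter pf (hp 1%N isT isT) (hp 3%N isT isT).
- have [u [v [e e' hu hv]]] := par2P (hp 2%N isT isT).
  case: hu => hu; first by case: hv => hv; rewrite e hv hu ?mul1g // in n1 *.
  case: (sc_indep pf (i := i0)) => /=; rewrite -hu.
  have -> : u = v^-1 * (x^-1 * y) by rewrite e' mulKg.
  apply: generatedM; last exact: hp.
  by apply: generatedV; case: hv => ->; [apply: generated1|apply: par_gen].
Qed.

Lemma coset_cayley_system : cayley_system (cface C) rho.
Proof.
split; [exact: coset_flag_system|exact: (sc_gen pf)|].
move=> u g h k l k5 l5 /(cface_le _ _ k5 l5)[kl [x [e1 e2]]].
have left y z j (j5 : (j < 5)%N) : cface C y j = cface C z j ->
    cface C (u * y) j = cface C (u * z) j.
  by move=> /cface_eqP-/(_ j5) h'; apply/cface_eqP; rewrite // invgM -mulgA mulKg.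
apply/cface_le => //; split=> //; exists (u * x).
by split; apply: left.
Qed.

Let fs := coset_flag_system.

(** The flags through both ends of a section form a coset of the group generated
    by the rho_m whose rank lies strictly inside the section.  Appending such a
    generator changes a single face, and the section has another rank available,
    so a word in these generators becomes a path of incident faces. *)
Lemma coset_connected (F F' : R) : F <= F' -> connected_section F F'.
Proof.
have [g [i [i5 ->]]] := cfaceP F; have [h [j [j5 ->]]] := cfaceP F'.
move=> le; have ij := fs_rank fs i5 j5 le.
have [x [<- <-]] := face_pair fs ij j5 le.
have [ji|ji] := leqP j i.+2.
  left=> r s /(has_rank_face fs _ _ i5) -> /(has_rank_face fs _ _ j5) ->.
  lia.
right.
pose S := [set rho m | m in [set m : 'I_3 | (i < m.+1 < j)%N]].
pose inside (y : R) := cface C x i < y < cface C x j.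
pose conn (u v : R) := exists s : seq R,
  [/\ path (fun u v => u >=< v) u s, last u s = v & all inside s].
have conn_trans u v w : conn u v -> conn v w -> conn u w.
  move=> [s [p1 l1 a1]] [t [p2 l2 a2]]; exists (s ++ t).
  by rewrite cat_path last_cat all_cat p1 l1 a1 p2 l2 a2.
have conn_step y k k' : cface C y i = cface C x i -> cface C y j = cface C x j ->
    (i < k < j)%N -> (i < k' < j)%N -> conn (cface C y k) (cface C y k').
  move=> yi yj hk hk'; exists [:: cface C y k'].
  have k5 : (k < 5)%N by lia.
  have k5' : (k' < 5)%N by lia.
  split=> //=; rewrite andbT.
    by case/orP: (leq_total k k') => kk; apply/orP; [left|right]; apply: (fs_chain fs).
  by rewrite /inside -yi -yj !(face_ltE fs) //; lia.
have between (y : R) : inside y -> exists z k,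
    [/\ (i < k < j)%N, y = cface C z k, cface C z i = cface C x i &
        cface C z j = cface C x j].
  have [w [k [k5 ->]]] := cfaceP y => /andP[lt1 lt2].
  have ik := face_lt fs i5 k5 lt1; have kj := face_lt fs k5 j5 lt2.
  have [z sub] : exists z, [set u | [\/ u = cface C x i, u = cface C w k | u = cface C x j]]
      `<=` flag_faces (cface C) z.
    apply: (chain_in_flag fs) => u v.
    have lt3 := lt_trans lt1 lt2.
    by case=> ->; case=> ->; rewrite ?lexx ?(ltW lt1) ?(ltW lt2) ?(ltW lt3); auto.
  exists z, k; split; first by rewrite ik.
  - by apply: (in_flag_of (fs := fs)) => //; apply: sub; apply: Or32.
  - by apply/esym/(in_flag_of (fs := fs)) => //; apply: sub; apply: Or31.
  - by apply/esym/(in_flag_of (fs := fs)) => //; apply: sub; apply: Or33.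
have stabS w : par i w -> par j w -> generated S w.
  (* as j - i >= 3, one end is the least or the greatest face, so the stabilizer
     of both ends is that of the other end *)
  have ex : exists k, (k = i \/ k = j) /\ forall m : 'I_3, m.+1 <> k -> (i < m.+1 < j)%N.
    have [e|i0] := posnP i.
      by exists j; split; [right|move=> m mj; have := ltn_ord m; lia].
    by exists i; split; [left|move=> m mj; have := ltn_ord m; lia].
  have [k [hk hm]] := ex => wi wj.
  have : par k w by case: hk => ->.
  move: w {wi wj}; apply: generated_ind => [|y z|_ [m /hm mS <-]].
  - exact: generated1.
  - exact: generatedD.
  - by apply: generated_mem; exists m.
have walk y k : cface C y i = cface C x i -> cface C y j = cface C x j ->
    (i < k < j)%N -> forall w, generated S w ->
    [/\ cface C (y * w) i = cface C x i, cface C (y * w) j = cface C x j &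
      forall k', (i < k' < j)%N -> conn (cface C y k) (cface C (y * w) k')].
  move=> yi yj hk; apply: generated_words => [_ [m _ <-]||w _ [wi wj wc] [m mS <-]].
  - exact: (sc_invol pf).
  - by rewrite mulg1; split=> // k' hk'; apply: conn_step.
  have step l : (l < 5)%N -> l <> m.+1 -> cface C (y * (w * rho m)) l = cface C (y * w) l.
    by move=> l5 lm; rewrite mulgA; apply: (nb_face fs).
  move: mS => /= mS.
  split; [rewrite step //; lia|rewrite step //; lia|move=> k' hk'].
  have [l [hl lm]] : exists l, (i < l < j)%N /\ l <> m.+1.
    have [e|ne] := eqVneq i.+1 m.+1; last by exists i.+1; split; [lia|apply/eqP].
    by exists i.+2; split; lia.
  apply: conn_trans (wc l hl) _; rewrite -step //; last by lia.
  by apply: conn_step; rewrite ?step //; lia.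
move=> u v /between[y [k [hk -> yi yj]]] /between[z [l [hl -> zi zj]]].
have [|_ _ /(_ l hl)] := walk y k yi yj hk (y^-1 * z).
  apply: stabS; first by apply/cface_eqP; rewrite ?yi ?zi.
  by apply/cface_eqP; rewrite ?yj ?zj.
by rewrite mulVKg.
Qed.

Theorem coset_regular_polyhedron : regular_polyhedron R.
Proof.
split; last exact: cayley_regular coset_cayley_system.
exact: (flag_system_polyhedron fs) coset_connected.
Qed.

End CosetPolyhedron.

(** * Minimal regular covers *)
Lemma flag_system_iso d d' (P : tbPOrderType d) (R : tbPOrderType d') X
    (face : X -> nat -> R) nb (t : R -> P) :
  bijective t -> {mono t : x y / x <= y} ->
  flag_system face nb -> flag_system (fun x k => t (face x k)) nb.
Proof.
move=> tbij tm fs; have tinj := bij_inj tbij; split.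
- move=> z; have [u uK Ku] := tbij; have [x [k [k5 e]]] := fs_cover fs (u z).
  by exists x, k; rewrite -e Ku.
- by move=> x k l kl l5; rewrite tm; apply: (fs_chain fs).
- by move=> x y k l k5 l5; rewrite tm; apply: (fs_rank fs).
- by move=> x y k k5; rewrite tm => /(fs_level fs k5) ->.
- move=> x y k l kl l4; rewrite tm => /(fs_pair fs kl l4)[z [e1 e2]].
  by exists z; rewrite e1 e2.
- move=> x y w; rewrite !tm => h1 h2; have [z [e1 e2 e3]] := fs_triple fs h1 h2.
  by exists z; rewrite e1 e2 e3.
- by move=> x y h; apply: (fs_inj fs) => k /h/tinj.
- move=> i x y; rewrite -(fs_nb fs); split=> -[ne h]; split=> // k k5 ki.
    exact/tinj/h.
  by rewrite h.
Qed.

Lemma cayley_system_iso d d' (P : tbPOrderType d) (R : tbPOrderType d') (G : groupType)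
    (face : G -> nat -> R) rho (t : R -> P) :
  bijective t -> {mono t : x y / x <= y} ->
  cayley_system face rho -> cayley_system (fun x k => t (face x k)) rho.
Proof.
move=> tbij tm cs; split; [exact: flag_system_iso (cs_flags cs)|exact: (cs_gen cs)|].
by move=> u g h k l k5 l5; rewrite !tm; apply: (cs_left cs).
Qed.

Lemma multiplicative_inverse (G H : groupType) (f : {multiplicative G -> H}) :
  bijective f -> exists g : {multiplicative H -> G}, cancel f g.
Proof.
case=> g fK gK.
have gM : {morph g : x y / x * y}.
  by move=> x y; apply: (can_inj fK); rewrite gmulfM !gK.
pose gm := isMultiplicative.Build H G g gM.
by pose gh : {multiplicative H -> G} := HB.pack g gm; exists gh.
Qed.

Section MinimalCover.
Variables (d d' : Order.disp_t) (Q : tbPOrderType d') (r : 'I_3 -> Mon Q).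
Hypothesis r_mon : forall i, is_monodromy i (mon_fun (r i)).
Hypothesis mon_uniq : forall i (s s' : Sym (flag Q)),
  is_monodromy i s -> is_monodromy i s' -> s = s'.
Hypothesis r_C : is_string_C_group r.

Let C : string_C_group (Mon Q) := StringCGroup r_C.
Local Notation R := (coset_face C).
Let cs := coset_cayley_system C.

Lemma coset_covers : covers R Q.
Proof.
exists (flag_of (cs_flags cs) 1), (cayley_map cs 1 \o r); split.
  exact: cayley_map_distinguished.
have [g gK] := multiplicative_inverse (f := cayley_map cs 1) (cayley_map_bij cs 1).
by exists g => i; rewrite /= gK.
Qed.

Lemma covers_coset (P : tbPOrderType d) : covers P Q -> covers P R.
Proof.
move=> [Phi [rho [dist [f fmon]]]]; exists Phi, rho; split=> //.
have [g gmon] := cayley_mon_ex cs; exists (g \o f) => i /=.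
suff -> : f (rho i) = r i by exact: gmon.
by apply: val_inj; apply: mon_uniq (fmon i) (r_mon i).
Qed.

Theorem minimal_cover_aut (P : tbPOrderType d) (Phi : flag P) (rho : 'I_3 -> Aut P) :
  minimal_regular_cover P Q -> distinguished Phi rho ->
  exists f : {multiplicative Mon Q -> Aut P},
    bijective f /\ forall i, f (r i) = rho i.
Proof.
move=> [_ PQ min].
have [t [tbij tm]] := min _ R (coset_regular_polyhedron C) coset_covers (covers_coset PQ).
exact: cayley_iso (cayley_system_iso tbij tm cs) _ _.
Qed.

End MinimalCover.

(** * Groups satisfying the relations *)
Section WordProduct.
Variables (G : groupType) (g : 'I_3 -> G).

Definition wprod (w : seq 'I_3) : G := foldr (fun i x => g i * x) 1 w.

Lemma wprod_cat w1 w2 : wprod (w1 ++ w2) = wprod w1 * wprod w2.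
Proof. by elim: w1 => [|i w1 IH] /=; rewrite ?mul1g // IH mulgA. Qed.

Lemma wprod_power w k : wprod (flatten (nseq k w)) = wprod w ^+ k.
Proof. by elim: k => [|k IH] //=; rewrite wprod_cat IH expgS. Qed.
End WordProduct.

Lemma wprod_morph (G H : groupType) (f : {multiplicative G -> H}) g w :
  f (wprod g w) = wprod (f \o g) w.
Proof. elim: w => [|i w IH] /=; last by rewrite gmulfM IH.
by apply: (mulgI (f 1)); rewrite -gmulfM !mulg1.
Qed.

(** The short relators are spelled as words, which unfold to explicit products;
    the power of ab is kept as a power because its exponent varies. *)
Record antiprism_relations (G : groupType) (l : nat) (g : 'I_3 -> G) : Prop :=
  AntiprismRelations {
  rel_a : g i0 * g i0 = 1;
  rel_b : g i1 * g i1 = 1;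
  rel_c : g i2 * g i2 = 1;
  rel_ac : wprod g [:: i0; i2; i0; i2] = 1;
  rel_bc : wprod g [:: i1; i2; i1; i2; i1; i2; i1; i2] = 1;
  rel_ab : (g i0 * g i1) ^+ l = 1;
  rel_extra : let w := [:: i2; i0; i1; i0; i1; i2; i1; i2; i0; i1; i0; i1] in
    wprod g (w ++ w) = 1
}.

Lemma relations_invol (G : groupType) l (g : 'I_3 -> G) :
  antiprism_relations l g -> forall i, g i * g i = 1.
Proof.
move=> rel i; have [->|->|->] := ord3P i.
- exact: (rel_a rel).
- exact: (rel_b rel).
- exact: (rel_c rel).
Qed.

Lemma commuteJ (G : groupType) (x y z : G) : commute x y -> commute (x ^ z) (y ^ z).
Proof. by rewrite /commute -!conjMg => ->. Qed.

Lemma commuteVl (G : groupType) (x y : G) : commute x^-1 y -> commute x y.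
Proof. by move=> /commute_sym/commuteV; rewrite invgK => /commute_sym. Qed.

Lemma commuteVr (G : groupType) (x y : G) : commute x y^-1 -> commute x y.
Proof. by move=> /commuteV; rewrite invgK. Qed.

(** In the Coxeter group [3,4] these words represent the subgroup <b, c>, dihedral
    of order 8, and the [transversal_words] its six cosets, which are the vertices
    of the octahedron. *)
Definition dihedral_words : seq (seq 'I_3) :=
  [:: [::]; [:: i1]; [:: i2]; [:: i1; i2]; [:: i2; i1]; [:: i1; i2; i1];
      [:: i2; i1; i2]; [:: i1; i2; i1; i2]].

Definition transversal_words : seq (seq 'I_3) :=
  [:: [::]; [:: i0]; [:: i0; i1]; [:: i0; i1; i2]; [:: i0; i1; i2; i1];
      [:: i0; i1; i2; i1; i0]].

Section PowerProducts.
Variables (G : groupType) (x1 x2 x3 x4 : G).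
Hypotheses (c12 : commute x1 x2) (c13 : commute x1 x3) (c14 : commute x1 x4).
Hypotheses (c23 : commute x2 x3) (c24 : commute x2 x4) (c34 : commute x3 x4).

Definition power_products (x : G) : Prop :=
  exists i j k m, x = x1 ^+ i * x2 ^+ j * x3 ^+ k * x4 ^+ m.

Lemma power_products1 : power_products 1.
Proof. by exists 0%N, 0%N, 0%N, 0%N; rewrite !mulg1. Qed.

Lemma power_products_mul1 x : power_products x -> power_products (x * x1).
Proof.
move=> [i [j [k [m ->]]]]; exists i.+1, j, k, m.
have h : commute x1 (x2 ^+ j * (x3 ^+ k * x4 ^+ m)).
  by do !apply: commuteM; apply: commuteX.
by rewrite expgSr -!mulgA; congr (_ * _); rewrite [RHS]h -!mulgA.
Qed.

Lemma power_products_mul2 x : power_products x -> power_products (x * x2).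
Proof.
move=> [i [j [k [m ->]]]]; exists i, j.+1, k, m.
have h : commute x2 (x3 ^+ k * x4 ^+ m) by apply: commuteM; apply: commuteX.
by rewrite expgSr -!mulgA; congr (_ * (_ * _)); rewrite [RHS]h -!mulgA.
Qed.

Lemma power_products_mul3 x : power_products x -> power_products (x * x3).
Proof.
move=> [i [j [k [m ->]]]]; exists i, j, k.+1, m.
have h : commute x3 (x4 ^+ m) by apply: commuteX.
by rewrite expgSr -!mulgA; congr (_ * (_ * (_ * _))); rewrite [RHS]h.
Qed.

Lemma power_products_mul4 x : power_products x -> power_products (x * x4).
Proof. by move=> [i [j [k [m ->]]]]; exists i, j, k, m.+1; rewrite expgSr !mulgA. Qed.
End PowerProducts.

Section NormalForm.
Variables (G : groupType) (l : nat) (g : 'I_3 -> G).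
Hypothesis rel : antiprism_relations (3 * l) g.
Hypothesis l_gt0 : (0 < l)%N.
Local Notation a := (g i0).
Local Notation b := (g i1).
Local Notation c := (g i2).

Let aa := rel_a rel.
Let bb := rel_b rel.
Let cc := rel_c rel.
Let aK x : x * a * a = x. Proof. by rewrite -mulgA aa mulg1. Qed.
Let bK x : x * b * b = x. Proof. by rewrite -mulgA bb mulg1. Qed.
Let cK x : x * c * c = x. Proof. by rewrite -mulgA cc mulg1. Qed.
Let wE := (@mulgA G, (aK, bK, cK), (aa, bb, cc), @mulg1 G, @mul1g G).
Let aV : a^-1 = a. Proof. exact: mulg1_eq. Qed.
Let bV : b^-1 = b. Proof. exact: mulg1_eq. Qed.
Let cV : c^-1 = c. Proof. exact: mulg1_eq. Qed.

Let ac : a * c = c * a.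
Proof.
have := rel_ac rel; rewrite /= !wE => h.
by have := congr1 (fun x => x * c * a) h; rewrite !wE.
Qed.
Let caK x : x * c * a = x * a * c. Proof. by rewrite -!mulgA ac. Qed.

Let bcbc : c * b * c * b = b * c * b * c.
Proof.
have := rel_bc rel; rewrite /= !wE => h.
by have := congr1 (fun x => x * c * b * c * b) h; rewrite !wE => ->.
Qed.
Let cbcbK x : x * c * b * c * b = x * b * c * b * c.
Proof. by rewrite -!mulgA (mulgA c) (mulgA (c * b)) bcbc !mulgA. Qed.

(** The conjugate named after a type rotates the flags of that type in the
    antiprism. *)
Definition tA : G := (a * b) ^+ 3.
Definition tB : G := tA ^ c.
Definition tC : G := tB ^ b.
Definition tD : G := tC ^ a.

Let tAE : tA = a * b * a * b * a * b.
Proof. by rewrite /tA !expgS expg0 !wE. Qed.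
Let tAVE : tA^-1 = b * a * b * a * b * a.
Proof. by rewrite tAE !invgM aV bV !wE. Qed.

Let tAa : tA ^ a = tA^-1.
Proof. by rewrite conjgE aV tAVE tAE !wE. Qed.
Let tAb : tA ^ b = tA^-1.
Proof. by rewrite conjgE bV tAVE tAE !wE. Qed.
Let tAc : tA ^ c = tB. Proof. by []. Qed.
Let tBc : tB ^ c = tA. Proof. by rewrite /tB -conjgM cc conjg1. Qed.
Let tBb : tB ^ b = tC. Proof. by []. Qed.
Let tBa : tB ^ a = tB^-1.
Proof. by rewrite /tB -conjgM -ac conjgM tAa conjVg. Qed.
Let tCb : tC ^ b = tB. Proof. by rewrite /tC -conjgM bb conjg1. Qed.
Let tCa : tC ^ a = tD. Proof. by []. Qed.
Let tDa : tD ^ a = tC. Proof. by rewrite /tD -conjgM aa conjg1. Qed.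

(** Writing w for the word whose square is the extra relator, w is conjugate to
    a c tC^-1.  So the extra relator says that the involution ac inverts tC. *)
Let tDc : tD ^ c = tC^-1.
Proof.
have extra : (a * c * tC^-1) * (a * c * tC^-1) = 1.
  pose w := wprod g [:: i2; i0; i1; i0; i1; i2; i1; i2; i0; i1; i0; i1].
  have -> : a * c * tC^-1 = w ^ (c * a * b).
    rewrite /w /tC /tB -!conjVg tAVE !conjgE !invgM aV bV cV /= !wE.
    by rewrite cbcbK !caK.
  rewrite -conjMg; apply/eqP; rewrite conjg_eq1; apply/eqP.
  by have := rel_extra rel; cbv zeta; rewrite wprod_cat.
have e : a * c * tC^-1 * (a * c) = tC.
  by apply: (mulIg tC^-1); rewrite mulgV -extra !mulgA.
apply: invg_inj; rewrite invgK -conjVg /tD -conjVg -conjgM -[RHS]e.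
by rewrite conjgE invgM aV cV !mulgA ac.
Qed.

Let tCc : tC ^ c = tD^-1.
Proof. by rewrite -[tC]invgK -tDc conjVg -conjgM cc conjg1. Qed.

(** Since tD^-1 = t ^ (cbc), and b commutes with cbc because (bc)^4 = 1, the
    relation t ^ b = t^-1 carries over to tD. *)
Let tDb : tD ^ b = tD^-1.
Proof.
have e : tD^-1 = tA ^ (c * b * c) by rewrite -tCc /tC /tB -!conjgM !mulgA.
rewrite -[tD in LHS]invgK e conjVg -conjgM bcbc -!mulgA conjgM tAb.
by rewrite conjVg invgK mulgA.
Qed.

(** Both bab and aba conjugate tB to tD^-1, and bab / aba is t^-1. *)
Let cAB : commute tA tB.
Proof.
apply/commute_sym/commuteVr/commgP; rewrite -conjg_fix; apply/eqP.
have e : tB ^ (b * a * b) = tB ^ (a * b * a).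
  by rewrite !conjgM tBb tCa tDb tBa conjVg tBb conjVg tCa.
have -> : tA^-1 = (b * a * b) / (a * b * a) by rewrite tAVE !invgM aV bV !wE.
by rewrite conjgM e conjgK.
Qed.
Let cAC : commute tA tC.
Proof. by apply: commuteVl; rewrite -tAb -tBb; apply: commuteJ. Qed.
Let cAD : commute tA tD.
Proof. by apply: commuteVl; rewrite -tAa -tCa; apply: commuteJ. Qed.
Let cBC : commute tB tC.
Proof. by apply: commuteVr; rewrite -tAc -tDc; apply: commuteJ. Qed.
Let cBD : commute tB tD.
Proof. by apply: commuteVr; rewrite -tAc -tCc; apply: commuteJ. Qed.
Let cCD : commute tC tD.
Proof. by apply: commuteVr; rewrite -tDb -tBb; apply: commuteJ. Qed.

Definition rotations : G -> Prop := power_products tA tB tC tD.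
Local Notation stable y := (forall x, rotations x -> rotations (x * y)).

Let rotations1 : rotations 1. Proof. exact: power_products1. Qed.
Let stable_tA : stable tA. Proof. exact: power_products_mul1. Qed.
Let stable_tB : stable tB. Proof. exact: power_products_mul2. Qed.
Let stable_tC : stable tC. Proof. exact: power_products_mul3. Qed.
Let stable_tD : stable tD. Proof. exact: power_products_mul4. Qed.

Let stableM y z : stable y -> stable z -> stable (y * z).
Proof. by move=> hy hz x tx; rewrite mulgA; apply/hz/hy. Qed.
Let stableX y k : stable y -> stable (y ^+ k).
Proof.
move=> hy; elim: k => [|k IH]; first by move=> x tx; rewrite expg0 mulg1.
by rewrite expgS; apply: stableM.
Qed.

Let expgl_inv (y : G) : y ^+ l = 1 -> y^-1 = y ^+ l.-1.
Proof. by move=> yl; apply: mulg1_eq; rewrite -expgS prednK. Qed.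

Let tAl : tA ^+ l = 1. Proof. by rewrite -expgnA; exact: (rel_ab rel). Qed.
Let tBl : tB ^+ l = 1. Proof. by rewrite -conjXg tAl conj1g. Qed.
Let tCl : tC ^+ l = 1. Proof. by rewrite -conjXg tBl conj1g. Qed.
Let tDl : tD ^+ l = 1. Proof. by rewrite -conjXg tCl conj1g. Qed.

Let rotationsM x y : rotations x -> rotations y -> rotations (x * y).
Proof.
move=> tx [i [j [k [m ->]]]]; move: x tx.
by do !apply: stableM; apply: stableX.
Qed.

Let rotations_stable x : stable x -> rotations x.
Proof. by move=> /(_ _ rotations1); rewrite mul1g. Qed.

Let rotationsJ x i : rotations x -> rotations (x ^ g i).
Proof.
have stV y : stable y -> y ^+ l = 1 -> stable y^-1.
  by move=> sy /expgl_inv ->; apply: stableX.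
move=> [j [k [m [p ->]]]]; rewrite 3!conjMg 4!conjXg.
apply: rotations_stable.
have [->|->|->] := ord3P i.
- by rewrite tAa tBa tCa tDa; do !apply: stableM; apply: stableX => //; apply: stV.
- by rewrite tAb tBb tCb tDb; do !apply: stableM; apply: stableX => //; apply: stV.
- by rewrite tAc tBc tCc tDc; do !apply: stableM; apply: stableX => //; apply: stV.
Qed.

Let rotationsJw x w : rotations x -> rotations (x ^ wprod g w).
Proof.
elim: w x => [|i w IH] x tx /=; first by rewrite conjg1.
by rewrite conjgM; apply/IH/rotationsJ.
Qed.

Definition dihedral (x : G) : Prop := exists2 w, w \in dihedral_words & x = wprod g w.

(** The eight words are closed under b and c because cbcb = bcbc. *)
Lemma dihedral_mul x (i : 'I_3) : i <> i0 -> dihedral x -> dihedral (x * g i).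
Proof.
move=> ia [w wD ->].
have [/ia //|->|->] := ord3P i; move: wD; rewrite !inE => /orP[/eqP->|/orP[/eqP->|/orP[/eqP->|/orP[/eqP->|/orP[/eqP->|/orP[/eqP->|/orP[/eqP->|/eqP->]]]]]]].
  + by exists [:: i1]; rewrite //= ?wE ?bcbc ?cbcbK ?wE.
  + by exists [::]; rewrite //= ?wE ?bcbc ?cbcbK ?wE.
  + by exists [:: i2; i1]; rewrite //= ?wE ?bcbc ?cbcbK ?wE.
  + by exists [:: i1; i2; i1]; rewrite //= ?wE ?bcbc ?cbcbK ?wE.
  + by exists [:: i2]; rewrite //= ?wE ?bcbc ?cbcbK ?wE.
  + by exists [:: i1; i2]; rewrite //= ?wE ?bcbc ?cbcbK ?wE.
  + by exists [:: i1; i2; i1; i2]; rewrite //= ?wE ?bcbc ?cbcbK ?wE.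
  + by exists [:: i2; i1; i2]; rewrite //= ?wE ?bcbc ?cbcbK ?wE.
  + by exists [:: i2]; rewrite //= ?wE ?bcbc ?cbcbK ?wE.
  + by exists [:: i1; i2]; rewrite //= ?wE ?bcbc ?cbcbK ?wE.
  + by exists [::]; rewrite //= ?wE ?bcbc ?cbcbK ?wE.
  + by exists [:: i1]; rewrite //= ?wE ?bcbc ?cbcbK ?wE.
  + by exists [:: i2; i1; i2]; rewrite //= ?wE ?bcbc ?cbcbK ?wE.
  + by exists [:: i1; i2; i1; i2]; rewrite //= ?wE ?bcbc ?cbcbK ?wE.
  + by exists [:: i2; i1]; rewrite //= ?wE ?bcbc ?cbcbK ?wE.
  + by exists [:: i1; i2; i1]; rewrite //= ?wE ?bcbc ?cbcbK ?wE.
Qed.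

Lemma wprodV w : (wprod g w)^-1 = wprod g (rev w).
Proof.
have gV i : (g i)^-1 = g i by have [->|->|->] := ord3P i.
elim: w => [|i w IH] /=; first by rewrite invg1.
by rewrite rev_cons -cats1 wprod_cat invgM IH /= mulg1 gV.
Qed.

(** The coset enumeration of [3,4] over <b, c>.  The only products that use
    (ab)^3 = 1 in [3,4] are ab.a, abc.a and abcba.b; here they leave behind a
    conjugate of a power of t. *)
Lemma transversal_mul w i : w \in transversal_words ->
  exists n s w', [/\ rotations n, s = 1 \/ (exists2 j, j <> i0 & s = g j),
    w' \in transversal_words & wprod g w * g i = n * s * wprod g w'].
Proof.
have stay w1 w2 : w2 \in transversal_words -> wprod g w1 * g i = wprod g w2 ->
    exists n s w', [/\ rotations n, s = 1 \/ (exists2 j, j <> i0 & s = g j),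
    w' \in transversal_words & wprod g w1 * g i = n * s * wprod g w'].
  by move=> w2T e; exists 1, 1, w2; rewrite !mul1g; split=> //; left.
have sb : b = 1 \/ (exists2 j, j <> i0 & b = g j) by right; exists i1.
have sc : c = 1 \/ (exists2 j, j <> i0 & c = g j) by right; exists i2.
have trtA := rotations_stable stable_tA.
move: stay; have [->|->|->] := ord3P i => stay; rewrite !inE.
- move=> /orP[/eqP->|/orP[/eqP->|/orP[/eqP->|/orP[/eqP->|/orP[/eqP->|/eqP->]]]]].
  + by apply: (stay _ [:: i0]); rewrite //= !wE.
  + by apply: (stay _ [::]); rewrite //= !wE.
  + by exists tA, b, [:: i0; i1]; split=> //; rewrite tAE /= !wE.
  + by exists tA, b, [:: i0; i1; i2]; split=> //; rewrite tAE /= !wE caK.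
  + by apply: (stay _ [:: i0; i1; i2; i1; i0]); rewrite //= !wE.
  + by apply: (stay _ [:: i0; i1; i2; i1]); rewrite //= !wE.
- move=> /orP[/eqP->|/orP[/eqP->|/orP[/eqP->|/orP[/eqP->|/orP[/eqP->|/eqP->]]]]].
  + by exists 1, b, [::]; split=> //=; rewrite !wE.
  + by apply: (stay _ [:: i0; i1]); rewrite //= !wE.
  + by apply: (stay _ [:: i0]); rewrite //= !wE.
  + by apply: (stay _ [:: i0; i1; i2; i1]); rewrite //= !wE.
  + by apply: (stay _ [:: i0; i1; i2]); rewrite //= !wE.
  (* bab = t^-1 aba, and t^-1 moves to the front through abc = (cba)^-1 *)
  + exists (tA^-1 ^ wprod g [:: i2; i1; i0] * tA), b, [:: i0; i1; i2; i1; i0].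
    split=> //.
      apply: rotationsM trtA; apply: rotationsJw.
      by rewrite (expgl_inv tAl); apply/rotations_stable/stableX.
    by rewrite tAVE tAE conjgE /= !wE !invgM aV bV cV !wE !caK !wE.
- move=> /orP[/eqP->|/orP[/eqP->|/orP[/eqP->|/orP[/eqP->|/orP[/eqP->|/eqP->]]]]].
  + by exists 1, c, [::]; split=> //=; rewrite !wE.
  + by exists 1, c, [:: i0]; split=> //=; rewrite !wE ac.
  + by apply: (stay _ [:: i0; i1; i2]); rewrite //= !wE.
  + by apply: (stay _ [:: i0; i1]); rewrite //= !wE.
  + by exists 1, c, [:: i0; i1; i2; i1]; split=> //=; rewrite !wE -ac -cbcbK.
  + exists 1, c, [:: i0; i1; i2; i1; i0]; split=> //=.
    by rewrite !wE -caK -ac -cbcbK.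
Qed.

Lemma normal_form_mul x : exists n d w, [/\ rotations n, dihedral d,
  w \in transversal_words & wprod g x = n * d * wprod g w].
Proof.
elim/last_ind: x => [|x i [n [d [w [tn [wd wdD ->] wT e]]]]].
  by exists 1, 1, [::]; rewrite !mul1g; split=> //; exists [::].
rewrite -cats1 wprod_cat e /= mulg1 -mulgA.
have [n' [s [w' [tn' hs w'T ->]]]] := transversal_mul i wT.
exists (n * n' ^ (wprod g wd)^-1), (wprod g wd * s), w'; split=> //.
- by apply: rotationsM => //; rewrite wprodV; apply: rotationsJw.
- have dd : dihedral (wprod g wd) by exists wd.
  by case: hs => [->|[j ja ->]]; [rewrite mulg1|apply: dihedral_mul].
- by rewrite conjgE invgK !mulgA mulgVK.
Qed.

End NormalForm.

Definition wordA : seq 'I_3 := [:: i0; i1; i0; i1; i0; i1].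
Definition wordB : seq 'I_3 := i2 :: wordA ++ [:: i2].
Definition wordC : seq 'I_3 := i1 :: wordB ++ [:: i1].
Definition wordD : seq 'I_3 := i0 :: wordC ++ [:: i0].
Definition rotation_word (i j k m : nat) : seq 'I_3 :=
  flatten (nseq i wordA) ++ flatten (nseq j wordB) ++
  flatten (nseq k wordC) ++ flatten (nseq m wordD).

Lemma word_order (G : groupType) (l : nat) (g : 'I_3 -> G) :
  antiprism_relations (3 * l) g ->
  [/\ wprod g wordA ^+ l = 1, wprod g wordB ^+ l = 1, wprod g wordC ^+ l = 1
    & wprod g wordD ^+ l = 1].
Proof.
move=> rel.
have gV s : (g s)^-1 = g s by apply: mulg1_eq; exact: relations_invol rel s.
have eA : wprod g wordA ^+ l = 1.
  by rewrite -(rel_ab rel) expgnA /= !expgS expg0 !mulgA !mulg1.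
have step w i : wprod g w ^+ l = 1 -> wprod g (i :: w ++ [:: i]) ^+ l = 1.
  move=> wl; have -> : wprod g (i :: w ++ [:: i]) = wprod g w ^ g i.
    by rewrite conjgE gV /= wprod_cat /= mulg1.
  by rewrite -conjXg wl conj1g.
have eB := step _ i2 eA; have eC := step _ i1 eB; have eD := step _ i0 eC.
by split; [exact: eA|exact: eB|exact: eC|exact: eD].
Qed.

Lemma normal_form (G : groupType) (l : nat) (g : 'I_3 -> G) x :
  antiprism_relations (3 * l) g -> (0 < l)%N ->
  exists i j k m wd wr, [/\ wd \in dihedral_words, wr \in transversal_words &
    wprod g x = wprod g (rotation_word i j k m ++ wd ++ wr)].
Proof.
move=> rel l0; have [_ [_ [wr [[i [j [k [m ->]]]] [wd wdD ->] wrT ->]]]] :=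
  normal_form_mul rel l0 x.
exists i, j, k, m, wd, wr; split=> //.
have gV s : (g s)^-1 = g s by apply: mulg1_eq; exact: relations_invol rel s.
have eA : wprod g wordA = tA g by rewrite /tA !expgS expg0 /= !mulgA.
have eB : wprod g wordB = tB g.
  by rewrite /tB conjgE gV -eA /= !mulgA !mulg1.
have eC : wprod g wordC = tC g by rewrite /tC conjgE gV -eB /= !mulgA !mulg1.
have eD : wprod g wordD = tD g by rewrite /tD conjgE gV -eC /= !mulgA !mulg1.
by rewrite /rotation_word !wprod_cat !wprod_power eA eB eC eD !mulgA.
Qed.

(** * Presented groups *)
Section Presentation.
Local Open Scope quotient_scope.
Variables (X : choiceType) (R : seq (word X)).

Definition word_eval (H : groupType) (h : X -> H) (w : word X) : H :=
  foldr (fun p y => (if p.2 then h p.1 else (h p.1)^-1) * y) 1 w.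

Lemma word_eval_cat (H : groupType) (h : X -> H) w1 w2 :
  word_eval h (w1 ++ w2) = word_eval h w1 * word_eval h w2.
Proof. by elim: w1 => [|p w1 IH] /=; rewrite ?mul1g // IH mulgA. Qed.

Lemma word_eval_pow (H : groupType) (h : X -> H) w k :
  word_eval h (word_pow w k) = word_eval h w ^+ k.
Proof. by elim: k => [|k IH] //=; rewrite word_eval_cat IH expgS. Qed.

Lemma proj_cat w1 w2 : \pi_(presented R) (w1 ++ w2) =
  (\pi_(presented R) w1 : presented R) * \pi_(presented R) w2.
Proof.
apply/presented_eqP/cong_cat; apply: cong_sym; exact: word_cong_repr.
Qed.

Lemma proj_eval w :
  \pi_(presented R) w = word_eval (presented_gen R) w :> presented R.
Proof.
elim: w => [//|[x e] w IH] /=; rewrite -cat1s proj_cat IH; congr (_ * _).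
case: e => //; apply/esym/mulg1_eq.
rewrite -[presented_gen R x]/(\pi_(presented R) [:: (x, true)]) -proj_cat.
exact/presented_eqP/cong_cancel.
Qed.

Lemma relator_eval r : r \in R -> word_eval (presented_gen R) r = 1.
Proof. by move=> rR; rewrite -proj_eval; apply/presented_eqP/cong_relator. Qed.

(** The universal property of a presentation. *)
Lemma presented_hom (H : groupType) (h : X -> H) :
  (forall r, r \in R -> word_eval h r = 1) ->
  exists f : {multiplicative presented R -> H}, forall x, f (presented_gen R x) = h x.
Proof.
move=> hR.
have ev_cong w1 w2 : word_cong R w1 w2 -> word_eval h w1 = word_eval h w2.
  elim=> //; [by move=> ? ? ? _ -> _ ->|by move=> *; rewrite !word_eval_cat; congr (_ * _)|].
  by move=> x [] /=; rewrite mulg1 ?mulgV ?mulVg.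
pose f (g : presented R) := word_eval h (repr g).
have fM : {morph f : x y / x * y}.
  move=> x y; rewrite -word_eval_cat; apply: ev_cong.
  exact: (word_cong_repr R (repr x ++ repr y)).
pose fm := isMultiplicative.Build (presented R) H f fM.
pose fh : {multiplicative presented R -> H} := HB.pack f fm.
exists fh => x; have <- : word_eval h (letter x) = h x by rewrite /= mulg1.
exact: ev_cong (word_cong_repr R (letter x)).
Qed.

Lemma presented_wordE (g : presented R) : exists w, g = word_eval (presented_gen R) w.
Proof. by exists (repr g); rewrite -proj_eval reprK. Qed.
End Presentation.

Lemma antiprism_relators_eval (H : groupType) (h : 'I_3 -> H) l :
  (forall r, r \in antiprism_cover_relators l -> word_eval h r = 1) <->
  antiprism_relations l h.
Proof.
split=> [hR|[ra rb rc rac rbc rab rw] r].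
  have hN k : (k < 7)%N -> word_eval h (nth [::] (antiprism_cover_relators l) k) = 1.
    by move=> k7; apply/hR/mem_nth.
  split.
  - by have := hN 0%N isT; rewrite /= mulg1.
  - by have := hN 1%N isT; rewrite /= mulg1.
  - by have := hN 2%N isT; rewrite /= mulg1.
  - exact: (hN 3%N isT).
  - exact: (hN 4%N isT).
  - have := hN 5%N isT; rewrite [nth _ _ _]/= word_eval_pow /=.
    by rewrite mulg1.
  - exact: (hN 6%N isT).
rewrite !inE => /orP[/eqP->|/orP[/eqP->|/orP[/eqP->|/orP[/eqP->|/orP[/eqP->|/orP[/eqP->|/eqP->]]]]]].
- by rewrite /= mulg1.
- by rewrite /= mulg1.
- by rewrite /= mulg1.
- exact: rac.
- exact: rbc.
- by rewrite word_eval_pow /= mulg1.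
- exact: rw.
Qed.

Lemma presented_generated_words (l : nat) (x : presented (antiprism_cover_relators l)) :
  (0 < l)%N ->
  exists w, x = wprod (presented_gen (antiprism_cover_relators l)) w.
Proof.
move=> l0; pose g := presented_gen (antiprism_cover_relators l).
have rel : antiprism_relations l g.
  by apply/antiprism_relators_eval => r; apply: relator_eval.
have gV s : (g s)^-1 = g s by apply: mulg1_eq; exact: relations_invol rel s.
have [w ->] := presented_wordE x; exists (map fst w).
elim: w => //= -[s e] w -> /=.
by case: e => //=; rewrite -[(presented_gen _ s)^-1]/((g s)^-1) gV.
Qed.

(** * Vertices of the antiprism numbered modulo 2n *)
Section CyclicVertices.
Import GRing.Theory.
Local Open Scope ring_scope.
Variable n : nat.
Hypothesis n_gt1 : (1 < n)%N.
Local Notation V := (antiprism_vertex n).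

Lemma Zn_natr_eq0 (k : nat) : (k%:R == 0 :> 'Z_n) = (n %| k)%N.
Proof. by rewrite -val_eqE /= val_Zp_nat. Qed.

Lemma Zn_intr_eq0 (k : int) : (k%:~R == 0 :> 'Z_n) = (n%:Z %| k)%Z.
Proof.
by case: k => k; rewrite ?NegzE ?mulrNz ?oppr_eq0 ?dvdzN Zn_natr_eq0.
Qed.

(** The vertex with number z, for u_i = 2i and v_i = 2i - 1. *)
Definition vertex_at (z : int) : V := (((z + 1) %/ 2)%Z%:~R, (z %% 2)%Z == 1).

Definition index_of (x : V) : int := (val x.1)%:Z *+ 2 - (x.2 : nat)%:Z.

Lemma index_ofK x : vertex_at (index_of x) = x.
Proof.
clear n_gt1; case: x => i s; rewrite /vertex_at /index_of /=; congr (_, _); last by case: s; lia.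
have -> : (((i : nat)%:Z *+ 2 - (s : nat)%:Z + 1) %/ 2)%Z = (i : nat)%:Z by case: s; lia.
exact: natr_Zp.
Qed.

Lemma vertex_at_eq a b : (vertex_at a == vertex_at b) = (n.*2%:Z %| a - b)%Z.
Proof.
rewrite /vertex_at xpair_eqE -subr_eq0 -rmorphB Zn_intr_eq0.
apply/andP/idP => [[/dvdzP[q e] /eqP e2]|/dvdzP[q e]].
  by apply/dvdzP; exists q; lia.
have e' : a = b + q * n%:Z *+ 2 by lia.
split; last by lia.
by apply/dvdzP; exists q; lia.
Qed.

Definition off (x : V) (k : int) : V := vertex_at (index_of x + k).

(** [off] is an action of the integers: numbers matter modulo 2n only. *)
Lemma off_vertex_at z k : off (vertex_at z) k = vertex_at (z + k).
Proof.
apply/eqP; rewrite vertex_at_eq opprD addrACA subrr addr0.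
by rewrite -vertex_at_eq index_ofK.
Qed.

Lemma offD x j k : off (off x j) k = off x (j + k).
Proof. by rewrite {2}/off off_vertex_at /off addrA. Qed.

Lemma off0 x : off x 0 = x. Proof. by rewrite /off addr0 index_ofK. Qed.

Lemma off_eq x j k : (off x j == off x k) = (n.*2%:Z %| j - k)%Z.
Proof. by rewrite vertex_at_eq opprD addrACA subrr add0r. Qed.

Lemma off2 (x : V) : off x 2 = (x.1 + 1, x.2).
Proof.
clear n_gt1.
rewrite /off /vertex_at -[x in RHS]index_ofK /vertex_at /=; congr (_, _); last by lia.
by rewrite -[1]/(1%:~R) -rmorphD; congr (_%:~R); lia.
Qed.

Lemma off_side (x : V) k : (off x k).2 = x.2 (+) ((k %% 2)%Z == 1).
Proof.
clear n_gt1; rewrite /off /vertex_at /= -[x in RHS]index_ofK /vertex_at /=; lia.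
Qed.

Lemma off1_u (i : 'Z_n) : off (antiprism_u i) 1 = antiprism_v (i + 1).
Proof.
clear n_gt1; rewrite /off /vertex_at /index_of /=; congr (_, _); last by lia.
rewrite -[i in RHS]natr_Zp -[1 in RHS]/(1%:~R) -[(nat_of_ord i)%:R]/((nat_of_ord i)%:Z%:~R).
by rewrite -intrD; congr (_%:~R); lia.
Qed.

Lemma off1_v (i : 'Z_n) : off (antiprism_v i) 1 = antiprism_u i.
Proof.
clear n_gt1; rewrite /off /vertex_at /index_of /=; congr (_, _); last by lia.
rewrite -[i in RHS]natr_Zp -[(nat_of_ord i)%:R]/((nat_of_ord i)%:Z%:~R).
by congr (_%:~R); lia.
Qed.

End CyclicVertices.

Arguments off : simpl never.

(** * Flags of the antiprism *)
Section AntiprismFlags.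
Import GRing.Theory.
Local Open Scope ring_scope.
Local Open Scope set_scope.
Variable n : nat.
Hypothesis n_ge4 : (4 <= n)%N.
Local Notation V := (antiprism_vertex n).

Let n_gt1 : (1 < n)%N. Proof. exact: leq_trans n_ge4. Qed.

(** The hypothesis n >= 4 enters here: vertices whose numbers differ by less
    than 8 <= 2n are distinct, which settles every comparison of edges and
    triangles near a given vertex. *)
Lemma off_small (x : V) j k : (`|j - k| < 8)%N -> (off x j == off x k) = (j == k).
Proof.
move=> small; rewrite off_eq //; apply/dvdzP/eqP => [[q e]|->].
  have [q0|q0] := eqVneq q 0; first by move: e; rewrite q0 mul0r; lia.
  by move: small; rewrite e abszM; nia.
by exists 0; rewrite subrr mul0r.
Qed.

Lemma off_small0 (x : V) j : (`|j| < 8)%N -> (off x j == x) = (j == 0).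
Proof. by move=> small; rewrite -{2}(off0 x) off_small ?subr0. Qed.

Definition edge (x : V) (d : int) : {set V} := [set x; off x d].
Definition tri (x : V) : {set V} := [set off x (-1); x; off x 1].
Definition ngon (x : V) : {set V} := [set y : V | y.2 == x.2].

Lemma edge_sym x d : edge (off x d) (- d) = edge x d.
Proof. by rewrite /edge offD // subrr off0 finset.setUC. Qed.

Lemma triP x y : reflect (exists2 j : int, (`|j| <= 1)%N & y = off x j) (y \in tri x).
Proof.
rewrite !inE; apply: (iffP idP) => [|[j j1 ->]].
  by case/orP => [/orP[]|] /eqP->; [exists (-1)|exists 0; rewrite ?off0|exists 1].
have [->|[->|->]] : j = -1 \/ j = 0 \/ j = 1 by lia.
- by rewrite eqxx.
- by rewrite off0 eqxx orbT.
- by rewrite eqxx !orbT.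
Qed.

Lemma mem_tri x j k : (`|k - j| <= 6)%N -> (off x k \in tri (off x j)) = (`|k - j| <= 1)%N.
Proof.
move=> small; apply/triP/idP => [[i i1 /eqP]|h].
  by rewrite offD // off_small; [move/eqP|]; lia.
by exists (k - j); rewrite // offD // subrKC.
Qed.

Lemma tri_inj x y : tri x = tri y -> x = y.
Proof.
move=> e; have /triP[j j1 xj] : x \in tri y by rewrite -e !inE eqxx orbT.
have h k : (`|k| <= 1)%N -> (`|(j + k)%R| <= 1)%N.
  move=> k1; have : off x k \in tri y by rewrite -e; apply/triP; exists k.
  by rewrite xj offD // -{2}(off0 y) mem_tri ?subr0; lia.
have j0 : j = 0 by have := h 1 isT; have := h (-1) isT; lia.
by rewrite xj j0 off0.
Qed.

Lemma mem_ngon (x : V) k : (off x k \in ngon x) = ((k %% 2)%Z == 0).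
Proof. by rewrite inE off_side; case: x.2 => /=; lia. Qed.

Lemma ngon_eq x y : y \in ngon x -> ngon y = ngon x.
Proof. by rewrite inE => /eqP e; apply/setP => z; rewrite !inE e. Qed.

Lemma tri_not_ngon x y : ~~ (tri x \subset ngon y).
Proof.
apply/negP => /fintype.subsetP h.
have /ngon_eq e : x \in ngon y by apply: h; rewrite !inE eqxx orbT.
by have : off x 1 \in ngon y; [apply: h; rewrite !inE eqxx !orbT|rewrite -e mem_ngon].
Qed.

Lemma card_edge x d : (0 < `|d| < 8)%N -> #|edge x d| = 2%N.
Proof. by move=> h; rewrite cards2 eq_sym off_small0; [|lia]; have -> : d != 0 by lia. Qed.

Lemma card_tri x : #|tri x| = 3%N.
Proof.
rewrite /tri finset.setUC cardsU1 cards2 !inE.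
by rewrite !off_small0 // off_small.
Qed.

Lemma card_ngon x : #|ngon x| = n.
Proof.
have -> : ngon x = [set (i, x.2) | i in 'Z_n].
  apply/setP => -[i s]; rewrite inE /=; apply/eqP/imsetP => [->|[j _ [_ ->]]//].
  by exists i.
by rewrite card_imset ?card_ord ?Zp_cast // => i j [].
Qed.

Lemma card_V : #|V| = n.*2.
Proof. by rewrite card_prod card_bool card_ord Zp_cast // muln2. Qed.

(** A flag (l, m, x, e) has vertex x and direction e.  The bit l tells whether
    its edge joins vertices of the same n-gon, and m whether its face is mapped
    to itself by the reflection that fixes x.  The types A, B, C, D are
    (l, m) = (1,1), (1,0), (0,0), (0,1). *)
Definition flag_index : Type := (bool * bool * V * bool)%type.

Definition sg (e : bool) : int := if e then 1 else -1.
Definition len (l : bool) : int := if l then 2 else 1.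

Definition face_set (p : flag_index) (k : nat) : {set V} :=
  let: (l, m, x, e) := p in
  match k with
  | 0 => finset.set0
  | 1 => [set x]
  | 2 => edge x (len l * sg e)
  | 3 => if m then if l then ngon x else tri x else tri (off x (sg e))
  | _ => finset.setT
  end.

Definition antiprism_nb (i : 'I_3) (p : flag_index) : flag_index :=
  let: (l, m, x, e) := p in
  match val i with
  | 0 => (l, if l then m else ~~ m, off x (len l * sg e), ~~ e)
  | 1 => if m then (l, m, x, ~~ e) else (~~ l, m, x, e)
  | _ => (l, ~~ m, x, e)
  end.

Lemma edge_in_lattice (x : V) d : d = 1 \/ d = 2 -> edge x d \in antiprism_edges n.
Proof.
rewrite /edge; case: x => i [] [->|->]; rewrite !inE.
- rewrite off1_v finset.setUC; apply/orP; left; apply/orP; right.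
  by apply/imsetP; exists i.
- rewrite off2 /=; do 2![apply/orP; left]; apply/orP; right.
  by apply/imsetP; exists i.
- by rewrite off1_u; apply/orP; right; apply/imsetP; exists i.
- by rewrite off2 /=; do 3![apply/orP; left]; apply/imsetP; exists i.
Qed.

Lemma edge_lattice A : A \in antiprism_edges n ->
  exists x l, A = edge x (len l).
Proof.
rewrite !inE => /orP[/orP[/orP[]|]|] /imsetP[i _ ->].
- by exists (antiprism_u i), true; rewrite /edge off2.
- by exists (antiprism_v i), true; rewrite /edge off2.
- by exists (antiprism_v i), false; rewrite /edge off1_v finset.setUC.
- by exists (antiprism_u i), false; rewrite /edge off1_u.
Qed.

Lemma ngon_setE s : ngon (0, s) = [set (i, s) | i : 'Z_n].
Proof.
apply/setP => -[i t]; rewrite inE /=; apply/eqP/imsetP => [->|[j _ [_ ->]]//].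
by exists i.
Qed.

Lemma tri_u (i : 'Z_n) :
  tri (antiprism_u i) = [set antiprism_v i; antiprism_v (i + 1); antiprism_u i].
Proof.
rewrite /tri off1_u -(off1_v) offD // subrr off0 off1_v.
by rewrite -!finset.setUA [[set antiprism_u i] :|: _]finset.setUC.
Qed.

Lemma tri_v (i : 'Z_n) : tri (antiprism_v (i + 1)) =
  [set antiprism_u i; antiprism_u (i + 1); antiprism_v (i + 1)].
Proof.
rewrite /tri off1_v -[in LHS]off1_u offD // subrr off0 off1_u.
by rewrite -!finset.setUA [[set antiprism_v _] :|: _]finset.setUC.
Qed.

Lemma face_lattice A : A \in antiprism_faces n <->
  (exists x, A = ngon x) \/ (exists x, A = tri x).
Proof.
split.
  rewrite !inE => /orP[/orP[/orP[]/eqP->|/imsetP[i _ ->]]|/imsetP[i _ ->]].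
  - by left; exists (0, false); rewrite ngon_setE.
  - by left; exists (0, true); rewrite ngon_setE.
  - by right; exists (antiprism_v (i + 1)); rewrite tri_v.
  - by right; exists (antiprism_u i); rewrite tri_u.
rewrite !inE => -[[[i s] ->]|[[i []] ->]].
- have -> : ngon (i, s) = ngon (0, s) by apply: ngon_eq; rewrite inE.
  by rewrite ngon_setE; case: s; rewrite eqxx ?orbT.
- do 1![apply/orP; left]; apply/orP; right; apply/imsetP; exists (i - 1) => //.
  by rewrite -tri_v subrK.
- by apply/orP; right; apply/imsetP; exists i => //; rewrite -tri_u.
Qed.

Lemma face_set_in_lattice p k : face_set p k \in antiprism_lattice n.
Proof.
case: p => [[[l m] x] e]; rewrite /antiprism_lattice.
have inFace : face_set (l, m, x, e) 3 \in antiprism_faces n.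
  apply/face_lattice => /=; case: m; last by right; exists (off x (sg e)).
  by case: l; [left; exists x|right; exists x].
have inEdge : edge x (len l * sg e) \in antiprism_edges n.
  clear inFace; case: e; first by rewrite mulr1; apply: edge_in_lattice; case: l; auto.
  rewrite mulrN1 -edge_sym opprK; apply: edge_in_lattice; case: l; auto.
case: k => [|[|[|[|k]]]]; rewrite 3!finset.in_setU.
- by rewrite /= !inE eqxx.
- do 2![apply/orP; left]; apply/orP; right; apply/imsetP; exists x => //.
- by rewrite -[face_set _ _]/(edge x (len l * sg e)) inEdge !orbT.
- by rewrite inFace !orbT.
- by rewrite /= !inE eqxx !orbT.
Qed.

Definition antiprism_face (p : flag_index) (k : nat) : antiprism n :=
  Sub (face_set p k) (face_set_in_lattice p k).

Lemma antiprism_faceE p k : val (antiprism_face p k) = face_set p k. Proof. exact: SubK. Qed.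

Lemma antiprism_face_eq p q k : antiprism_face p k = antiprism_face q k <-> face_set p k = face_set q k.
Proof. by split=> [/(congr1 val)|e]; [rewrite !antiprism_faceE|apply: val_inj; rewrite !antiprism_faceE]. Qed.

Lemma antiprism_face_le p q k l : (antiprism_face p k <= antiprism_face q l)%O = (face_set p k \subset face_set q l).
Proof. by []. Qed.

Lemma antiprism_face_cover z : exists p k, (k < 5)%N /\ z = antiprism_face p k.
Proof.
suff [p [k [k5 e]]] : exists p k, (k < 5)%N /\ val z = face_set p k.
  by exists p, k; split=> //; apply: val_inj.
pose x0 : V := (0, false).
have := valP z; rewrite /antiprism_lattice 3!finset.in_setU => /orP[/orP[/orP[]|]|].
- rewrite !inE => /orP[]/eqP->; first by exists (true, true, x0, true), 0%N.
  by exists (true, true, x0, true), 4%N.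
- by move=> /imsetP[x _ ->]; exists (true, true, x, true), 1%N.
- move=> /edge_lattice[x [l ->]]; exists (l, true, x, true), 2%N.
  by rewrite /= mulr1.
- move=> /face_lattice[[x ->]|[x ->]]; first by exists (true, true, x, true), 3%N.
  by exists (false, true, x, true), 3%N.
Qed.

Lemma nb_face_set (i : 'I_3) p k : k <> i.+1 -> face_set (antiprism_nb i p) k = face_set p k.
Proof.
have ng x d : (d %% 2)%Z == 0 -> ngon (off x d) = ngon x.
  by move=> d2; apply: ngon_eq; rewrite mem_ngon.
case: p => [[[l m] x] e]; have [->|->|->] := ord3P i; case: k => [|[|[|[|k]]]] //= _.
- have -> : len l * sg (~~ e) = - (len l * sg e) by case: l e => -[].
  by rewrite edge_sym.
- case: l m e => -[] [] /=; rewrite ?offD ?ng ?mulr1 ?off0 //.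
- by case: m.
- by case: m.
- by case: m.
- by case: m.
Qed.
Lemma len_sg_small l e : (0 < `|(len l * sg e)%R| < 8)%N.
Proof. by case: l e => -[]. Qed.

Lemma len_sg_inj l e l' e' : len l * sg e = len l' * sg e' -> l = l' /\ e = e'.
Proof. by case: l e l' e' => -[] [] []. Qed.

Lemma mem_tri_off (x : V) c d : (`|d - c| <= 1)%N -> off x d \in tri (off x c).
Proof. by move=> h; apply/triP; exists (d - c) => //; rewrite offD // subrKC. Qed.

Lemma edge_subset x d (A : {set V}) : (edge x d \subset A) = (x \in A) && (off x d \in A).
Proof. by rewrite finset.subUset !finset.sub1set. Qed.

Lemma face_set_step p k : face_set p k \subset face_set p k.+1.
Proof.
case: p => [[[l m] x] e]; case: k => [|[|[|k]]].
- exact: finset.sub0set.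
- by rewrite /= finset.sub1set !inE eqxx.
- have h d c : (`|c| <= 1)%N -> (`|d - c| <= 1)%N -> edge x d \subset tri (off x c).
    move=> h1 h2; rewrite edge_subset (mem_tri_off _ h2) -{1}[x]off0 mem_tri_off //.
    by rewrite sub0r abszN.
  rewrite [face_set _ 2]/=; case: m; last by apply: h; [case: e|case: l; case: e].
  case: l; last by rewrite -{2}[x]off0; apply: h => //; case: e.
  by rewrite edge_subset mem_ngon inE eqxx; case: e.
- by case: k => [|k]; exact: finset.subsetT.
Qed.

Lemma face_set_mono p k l : (k <= l)%N -> face_set p k \subset face_set p l.
Proof.
elim: l => [|l IH]; first by rewrite leqn0 => /eqP->.
rewrite leq_eqVlt => /orP[/eqP-> //|/IH h].
exact: fintype.subset_trans h (face_set_step p l).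
Qed.

Lemma card_face_set p k : (k < 5)%N ->
  (nth 0 [:: 0; 1; 2; 3; n.*2] k <= #|face_set p k| <= nth 0 [:: 0; 1; 2; n; n.*2] k)%N.
Proof.
case: p => [[[l m] x] e]; case: k => [|[|[|[|[|k]]]]] // _.
- by rewrite /= cards0.
- by rewrite /= cards1.
- by rewrite [face_set _ _]/= card_edge ?len_sg_small.
- rewrite /=; case: m; last by rewrite card_tri; lia.
  by case: l; rewrite ?card_ngon ?card_tri; lia.
- by rewrite /= cardsT card_V leqnn.
Qed.

Lemma face_set_rank p q k l : (k < 5)%N -> (l < 5)%N ->
  face_set p k \subset face_set q l -> (k <= l)%N.
Proof.
move=> k5 l5 /subset_leq_card; have := card_face_set p k5; have := card_face_set q l5.
case: k k5 => [|[|[|[|[|k]]]]] // _; case: l l5 => [|[|[|[|[|l]]]]] //= _; lia.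
Qed.

Lemma face_set_level p q k : (k < 5)%N -> face_set p k \subset face_set q k -> face_set p k = face_set q k.
Proof.
move=> k5 sub; apply/eqP; rewrite finset.eqEcard sub /=.
move: sub; have := card_face_set p k5; have := card_face_set q k5.
have [->|k3] := eqVneq k 3%N => [_ _ sub|]; last first.
  by case: k k5 k3 => [|[|[|[|[|k]]]]] // _ _ /andP[_ hq] /andP[hp _] _;
    exact: leq_trans hq hp.
case: p q sub => [[[l m] x] e] [[[l' m'] x'] e'] /=.
have tt y z : tri y \subset tri z -> (#|tri z| <= #|tri y|)%N by rewrite !card_tri.
have nn y z : ngon y \subset ngon z -> (#|ngon z| <= #|ngon y|)%N by rewrite !card_ngon.
have nt y z : ngon y \subset tri z -> (#|tri z| <= #|ngon y|)%N by rewrite card_tri card_ngon; lia.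
have tn y z : tri y \subset ngon z -> (#|ngon z| <= #|tri y|)%N.
  by move=> h; have := tri_not_ngon y z; rewrite h.
by case: m m' l l' => [] [] [] [] /=; first [exact: tt|exact: nn|exact: nt|exact: tn].
Qed.

(** The other end of an edge is the vertex of the 0-adjacent flag. *)
Lemma vertex_of_edge p y : y \in face_set p 2 ->
  exists q, (q = p \/ q = antiprism_nb i0 p) /\ face_set q 1 = [set y].
Proof.
case: p => [[[l m] x] e] /=; rewrite !inE => /orP[]/eqP->.
  by exists (l, m, x, e); split=> //; left.
by eexists; split; [right; reflexivity|].
Qed.

Lemma vertex_of_face p y : y \in face_set p 3 ->
  exists q, face_set q 1 = [set y] /\ face_set q 3 = face_set p 3.
Proof.
have tr c : y \in tri c -> exists q, face_set q 1 = [set y] /\ face_set q 3 = tri c.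
  move=> /triP[j j1 ->]; have [->|[->|->]] : j = -1 \/ j = 0 \/ j = 1 by lia.
  - by exists (false, false, off c (-1), true); rewrite /= offD // off0.
  - by exists (false, true, off c 0, true); rewrite /= off0.
  - by exists (false, false, off c 1, false); rewrite /= offD // off0.
case: p => [[[l m] x] e]; rewrite [face_set _ 3]/=; case: m; last exact: tr.
case: l; last exact: tr.
by move=> /ngon_eq <-; exists (true, true, y, true).
Qed.

(** An edge and a face containing it are completed without changing the vertex,
    the edge or the direction: only the bit m has to be adjusted. *)
Lemma edge_of_face p q : face_set p 2 \subset face_set q 3 ->
  exists z, [/\ face_set z 1 = face_set p 1, face_set z 2 = face_set p 2 & face_set z 3 = face_set q 3].
Proof.
case: p => [[[l m] x] e]; rewrite edge_subset => /andP[x1 x2].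
have tr c : x \in tri c -> off x (len l * sg e) \in tri c ->
    exists m', face_set (l, m', x, e) 3 = tri c.
  move=> /triP[j j1 xj]; rewrite {1}xj offD //.
  rewrite -{2}[c]off0 mem_tri ?subr0; last by case: l e {x1 x2} => -[]; rewrite /len /sg; lia.
  have -> : c = off x (- j) by rewrite xj offD // subrr off0.
  case: l e {x1 x2} => -[] /= h.
  - have -> : j = -1 by lia. by exists false.
  - have -> : j = 1 by lia. by exists false.
  - have [->|->] : j = -1 \/ j = 0 by lia. by exists false. by exists true; rewrite off0.
  - have [->|->] : j = 1 \/ j = 0 by lia. by exists false. by exists true; rewrite off0.
suff [m' e3] : exists m', face_set (l, m', x, e) 3 = face_set q 3 by exists (l, m', x, e).
move: x1 x2; case: q => [[[l' m''] y] e']; rewrite [face_set _ 3]/=.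
case: m''; last exact: tr.
case: l'; last exact: tr.
move=> /ngon_eq <-; rewrite mem_ngon => h; exists true.
by move: h; clear tr; case: l => //; case: e.
Qed.

(** The vertex and the edge determine l and the direction. *)
Lemma edge_flag p q : face_set p 1 = face_set q 1 -> face_set p 2 = face_set q 2 ->
  q = p \/ q = antiprism_nb i2 p.
Proof.
case: p q => [[[l m] x] e] [[[l' m'] x'] e'] /set1_inj <-.
rewrite [face_set _ 2]/= [face_set (l', m', x, e') 2]/= => h2.
have : off x (len l * sg e) \in edge x (len l' * sg e') by rewrite -h2 !inE eqxx orbT.
rewrite !inE off_small0; last by have := len_sg_small l e; lia.
rewrite off_small; last by case: l e l' e' {h2} => -[] [] [].
move=> /orP[/eqP z|/eqP /len_sg_inj[<- <-]].
  by have := len_sg_small l e; rewrite z.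
by case: m m' => -[]; auto.
Qed.

Lemma nb2_face p : face_set p 3 <> face_set (antiprism_nb i2 p) 3.
Proof.
have h l x e : face_set (l, true, x, e) 3 <> face_set (l, false, x, e) 3.
  case: l => /= h; first by have := tri_not_ngon (off x (sg e)) x; rewrite h fintype.subxx.
  have /esym/eqP := tri_inj h; rewrite off_small0; last by case: e {h}.
  by case: e {h}.
by case: p => [[[l []] x] e]; [|move/esym]; exact: h.
Qed.

Lemma face_set_inj p q : face_set p 1 = face_set q 1 -> face_set p 2 = face_set q 2 ->
  face_set p 3 = face_set q 3 -> p = q.
Proof. by move=> h1 h2; have [->|->] := edge_flag h1 h2 => // /nb2_face. Qed.

Lemma nb_neq (i : 'I_3) p : p <> antiprism_nb i p.
Proof.
case: p => [[[l m] x] e]; have [->|->|->] := ord3P i.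
- by move=> /(congr1 snd) /=; case: e.
- case: m => /= [/(congr1 snd)|/(congr1 (fun p => p.1.1.1))] /=; first by case: e.
  by case: l.
- by move=> /(congr1 (fun p => p.1.1.2)) /=; case: m.
Qed.

(** The vertex and the face determine the flag up to the choice of one of the
    two edges of the face at the vertex. *)
Lemma nb1_unique p q : face_set p 1 = face_set q 1 -> face_set p 3 = face_set q 3 ->
  q = p \/ q = antiprism_nb i1 p.
Proof.
case: p q => [[[l m] x] e] [[[l' m'] x'] e'] /set1_inj <-.
have shift d : tri x <> tri (off x (sg d)).
  by move=> /tri_inj/esym/eqP; rewrite off_small0; case: d.
have nt c y : ngon y <> tri c.
  by move=> h; have := tri_not_ngon c y; rewrite h fintype.subxx.
case: m m' l l' => [] [] [] [] /=; try by [move/nt|move/esym/nt|move/shift|move/esym/shift].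
- by case: e e' => [] []; auto.
- by case: e e' => [] []; auto.
all: move=> /tri_inj/eqP; rewrite off_small; last by [case: e; case: e'].
all: by case: e; case: e' => //= _; auto.
Qed.

Lemma antiprism_flag_system : flag_system antiprism_face antiprism_nb.
Proof.
have le_sub (A B : antiprism n) : (A <= B)%O -> val A \subset val B by [].
split.
- exact: antiprism_face_cover.
- by move=> p k l kl _; rewrite antiprism_face_le face_set_mono.
- by move=> p q k l k5 l5; rewrite antiprism_face_le; apply: face_set_rank.
- by move=> p q k k5; rewrite antiprism_face_le => /(face_set_level k5) e; apply/antiprism_face_eq.
- move=> p q k l; rewrite antiprism_face_le.
  case: k l => [|[|[|[|k]]]] [|[|[|[|l]]]] // _ _ sub.
  + have : (let: (l, m, x, e) := p in x) \in face_set q 2.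
      by move: sub; case: p => [[[? ?] ?] ?]; rewrite finset.sub1set.
    move=> /vertex_of_edge[z [zq e]]; exists z; split; apply/antiprism_face_eq.
      by rewrite e; case: p {sub e} => [[[? ?] ?] ?].
    by case: zq => ->; rewrite ?nb_face_set.
  + have : (let: (l, m, x, e) := p in x) \in face_set q 3.
      by move: sub; case: p => [[[? ?] ?] ?]; rewrite finset.sub1set.
    move=> /vertex_of_face[z [e1 e3]]; exists z; split; apply/antiprism_face_eq => //.
    by rewrite e1; case: p {sub e1} => [[[? ?] ?] ?].
  + have [z [_ e2 e3]] := edge_of_face sub.
    by exists z; split; apply/antiprism_face_eq.
- move=> p q w; rewrite !antiprism_face_le => s1 s2.
  have [z [_ e2 e3]] := edge_of_face s2.
  have : (let: (l, m, x, e) := p in x) \in face_set z 2.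
    by rewrite e2; move: s1; case: p => [[[? ?] ?] ?]; rewrite finset.sub1set.
  move=> /vertex_of_edge[y [yz e]]; exists y; split; apply/antiprism_face_eq.
  + by rewrite e; case: p {s1 e} => [[[? ?] ?] ?].
  + by rewrite -e2; case: yz => ->; rewrite ?nb_face_set.
  + by rewrite -e3; case: yz => ->; rewrite ?nb_face_set.
- by move=> p q h; apply: face_set_inj; apply/antiprism_face_eq/h.
move=> i p q; split=> [[ne h]|->]; last first.
  split; first exact: nb_neq.
  by move=> k _ ki; apply/antiprism_face_eq; rewrite nb_face_set.
have {}h k (k4 : (k < 5)%N) (ki : (k != i.+1)%N) : face_set p k = face_set q k.
  by apply/antiprism_face_eq/h => //; apply/eqP.
move: h; have [->|->|->] := ord3P i => h.
- have : (let: (l, m, x, e) := q in x) \in face_set p 2.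
    rewrite (h 2%N) //; apply/(fintype.subsetP (face_set_mono q (isT : (1 <= 2)%N))).
    by case: (q) => [[[? ?] ?] ?]; rewrite !inE.
  move=> /vertex_of_edge[z [zp e]]; have zq : z = q.
    apply: face_set_inj; first by rewrite e; case: (q) => [[[? ?] ?] ?].
      by rewrite -h //; case: zp => ->; rewrite ?nb_face_set.
    by rewrite -h //; case: zp => ->; rewrite ?nb_face_set.
  by case: zp => zp; [case: ne; rewrite -zp|rewrite -zp].
- by have [qp|//] := nb1_unique (h 1%N isT isT) (h 3%N isT isT); case: ne.
- by have [qp|//] := edge_flag (h 1%N isT isT) (h 2%N isT isT); case: ne.
Qed.

End AntiprismFlags.

(** * The monodromy group of the antiprism *)
Definition run X (nb : 'I_3 -> X -> X) (w : seq 'I_3) (x : X) : X :=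
  foldl (fun y i => nb i y) x w.

Lemma run_cat X (nb : 'I_3 -> X -> X) w1 w2 x : run nb (w1 ++ w2) x = run nb w2 (run nb w1 x).
Proof. exact: foldl_cat. Qed.

Section MonodromyWords.
Variables (d : Order.disp_t) (P : tbPOrderType d) (X : Type).
Variables (face : X -> nat -> P) (nb : 'I_3 -> X -> X).
Hypothesis fs : flag_system face nb.
Variable r : 'I_3 -> Mon P.
Hypothesis r_mon : forall i, is_monodromy i (mon_fun (r i)).

Lemma monodromy_run w x :
  mon_fun (wprod r w) (flag_of fs x) = flag_of fs (run nb w x).
Proof.
elim: w x => [//|i w IH] x /=.
rewrite -[LHS]/(mon_fun (wprod r w) (mon_fun (r i) (flag_of fs x))).
by rewrite (monodromyE fs (r_mon i)) IH.
Qed.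

Lemma monodromy_words_eq w1 w2 :
  wprod r w1 = wprod r w2 <-> forall x, run nb w1 x = run nb w2 x.
Proof.
split=> [e x|e].
  by apply: (flag_of_inj (fs := fs)); rewrite -!monodromy_run e.
apply/val_inj/symP => Psi; have [x ->] := flag_ofP fs Psi.
rewrite -![val (wprod _ _)]/(mon_fun (wprod _ _)).
by rewrite !monodromy_run e.
Qed.

Lemma monodromy_generated m : generated (range r) m.
Proof.
suff [m' [e gen]] : exists m' : Mon P, val m' = val m /\ generated (range r) m'.
  by rewrite -(val_inj e).
have := asboolW (valP m); move: (val m); apply: generated_ind.
- by exists 1; split=> //; apply: generated1.
- move=> _ _ [x [<- hx]] [y [<- hy]]; exists (x / y); split=> //.
  exact: generatedD.
- move=> s [i si]; exists (r i); split; last by apply: generated_mem; exists i.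
  exact: (monodromy_unique fs) (r_mon i) si.
Qed.
End MonodromyWords.

Lemma generated_wprod (G : groupType) (g : 'I_3 -> G) (A : 'I_3 -> Prop) x :
  (forall i, g i * g i = 1) -> generated [set g i | i in A] x ->
  exists w, (forall i, i \in w -> A i) /\ x = wprod g w.
Proof.
move=> inv; move: x; apply: generated_words.
- by move=> _ [i _ <-].
- by exists [::].
- move=> _ _ [w [wA ->]] [i Ai <-]; exists (w ++ [:: i]); split.
    by move=> j; rewrite mem_cat => /orP[/wA //|]; rewrite !inE => /eqP->.
  by rewrite wprod_cat /= mulg1.
Qed.

(** The action on types: a, b, c act as (C D), (B C), (A B)(C D). *)
Definition type_nb (i : 'I_3) (t : bool * bool) : bool * bool :=
  let: (l, m) := t in
  match val i with
  | 0 => (l, if l then m else ~~ m)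
  | 1 => if m then (l, m) else (~~ l, m)
  | _ => (l, ~~ m)
  end.

Lemma run_type n w (p : flag_index n) :
  (run (@antiprism_nb n) w p).1.1 = run type_nb w p.1.1.
Proof.
elim: w p => //= i w IH p; rewrite -[LHS]/((run (@antiprism_nb n) w (antiprism_nb i p)).1.1) IH.
by congr (run _ _ _); case: p i => [[[l m] x] e] [[|[|k]] ?] //=; case: m.
Qed.

Section AntiprismMonodromy.
Variable n : nat.
Hypothesis n_ge4 : (4 <= n)%N.
Let n_gt1 : (1 < n)%N. Proof. exact: leq_trans n_ge4. Qed.
Let fs := antiprism_flag_system n_ge4.
Local Notation nb := (@antiprism_nb n).
Local Open Scope ring_scope.
Import GRing.Theory.

(** The sign of a flag for an orientation of the sphere.  The parity of the
    vertex (the bit x.2) contributes because adding 1 to all numbers is a rotary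
    reflection of the antiprism. *)
Definition orientation (p : flag_index n) : bool :=
  let: (l, m, x, e) := p in l (+) m (+) x.2 (+) e.

Lemma orientation_nb i p : orientation (nb i p) = ~~ orientation p.
Proof.
case: p => [[[l m] x] e]; have [->|->|->] := ord3P i; rewrite -[orientation (l, m, x, e)]/(l (+) m (+) x.2 (+) e).
- rewrite -[orientation _]/(l (+) (if l then m else ~~ m)
    (+) (off x (len l * sg e)).2 (+) ~~ e) off_side.
  by case: l e m x.2 => -[] [] [].
- by case: x => k []; case: l m e => -[] [].
- by case: x => k []; case: l m e => -[] [].
Qed.

Lemma orientation_run w p : orientation (run nb w p) = orientation p (+) odd (size w).
Proof.
elim: w p => [|i w IH] p; first by rewrite addbF.
by rewrite -[run _ _ _]/(run nb w (nb i p)) IH orientation_nb /= addNb addbN.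
Qed.

Lemma off_id (x : antiprism_vertex n) k : (off x k == x) = (n.*2%:Z %| k)%Z.
Proof. by rewrite -{2}(off0 x) off_eq // subr0. Qed.

Lemma run_power w t c j x e :
  (forall y, run nb w (t, y, e) = (t, off y (c * sg e), e)) ->
  run nb (flatten (nseq j w)) (t, x, e) = (t, off x (c * j%:Z * sg e), e).
Proof.
move=> h; elim: j x => [|j IH] x; first by rewrite mulr0 mul0r off0.
rewrite /= run_cat h IH offD //; congr (_, off _ _, _); lia.
Qed.

Lemma offK (x : antiprism_vertex n) k : k = 0 -> off x k = x.
Proof. by move=> ->; rewrite off0. Qed.

Let steps (t : bool * bool) (w : seq 'I_3) (c : int) :=
  forall x e, run nb w (t, x, e) = (t, off x (c * sg e), e).

Ltac run_steps := move=> x []; rewrite /run /= ?offD //; congr (_, _, _);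
  first [by congr off | exact: offK | by apply/esym/offK].

(** Each of the four conjugates of (ab)^3 moves the flags of one type by three
    steps along an n-gon, which is 6 numbers, and fixes the others. *)
Lemma steps_wordA : [/\ steps (true, true) wordA 6, steps (true, false) wordA 0,
  steps (false, false) wordA 0 & steps (false, true) wordA 0].
Proof. by split; run_steps. Qed.
Lemma steps_wordB : [/\ steps (true, true) wordB 0, steps (true, false) wordB 6,
  steps (false, false) wordB 0 & steps (false, true) wordB 0].
Proof. by split; run_steps. Qed.
Lemma steps_wordC : [/\ steps (true, true) wordC 0, steps (true, false) wordC 0,
  steps (false, false) wordC 6 & steps (false, true) wordC 0].
Proof. by split; run_steps. Qed.
Lemma steps_wordD : [/\ steps (true, true) wordD 0, steps (true, false) wordD 0,
  steps (false, false) wordD 0 & steps (false, true) wordD (-6)].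
Proof. by split; run_steps. Qed.

Variable r : 'I_3 -> Mon (antiprism n).
Hypothesis r_mon : forall i, is_monodromy i (mon_fun (r i)).

Let eq1 w : (forall p, run nb w p = p) -> wprod r w = 1%g.
Proof. by move=> h; have -> := (monodromy_words_eq fs r_mon w [::]).2 h. Qed.

Ltac run_id := move=> [[[[] []] x] []]; rewrite /run /= ?offD //; congr (_, _, _);
  exact: offK.

Lemma antiprism_mon_relations l : (n %| 3 * l)%N -> antiprism_relations (3 * l) r.
Proof.
move=> n3l; split.
- have <- := @eq1 [:: i0; i0]; first by rewrite /= mulg1.
  by run_id.
- have <- := @eq1 [:: i1; i1]; first by rewrite /= mulg1.
  by case=> [[[[] []] x] []].
- have <- := @eq1 [:: i2; i2]; first by rewrite /= mulg1.
  by case=> [[[[] []] x] []].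
- by apply: eq1; run_id.
- by apply: eq1; run_id.
- rewrite expgnA; have <- := @eq1 (flatten (nseq l wordA)).
    by rewrite wprod_power /= !expgS expg0 !mulgA !mulg1.
  have [A B C D] := steps_wordA.
  have id0 t x e : steps t wordA 0 -> run nb (flatten (nseq l wordA)) (t, x, e) = (t, x, e).
    by move=> st; rewrite (run_power _ _ (st^~ e)) !mul0r off0.
  move=> [[[[] []] x] e]; [|exact: id0|exact: id0|exact: id0].
  rewrite (run_power _ _ (A^~ e)); congr (_, _, _); apply/eqP; rewrite off_id.
  apply: dvdz_mulr; move: n3l => /dvdnP[q e3]; apply/dvdzP; exists q%:Z.
  by rewrite -muln2; lia.
- by apply: eq1; run_id.
Qed.

(** Everything but the intersection of <b, c> with <a, b> is read off the types:
    <a, b> fixes the type A and c does not, <a, c> preserves {A, B} and b does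
    not, and no element of <b, c> both fixes A and sends D to C, as a does.
    Finally the stabilizer of A in the dihedral group <b, c> is {1, b}. *)
Lemma antiprism_mon_C_group : is_string_C_group r.
Proof.
have rel := antiprism_mon_relations (dvdn_mull 3 (dvdnn n)).
have inv i : (r i * r i = 1)%g by exact: relations_invol rel i.
have par k x : parabolic r k x ->
    exists w, (forall i : 'I_3, i \in w -> i.+1 <> k) /\ x = wprod r w.
  exact: generated_wprod.
have typ w1 w2 t : wprod r w1 = wprod r w2 -> run type_nb w1 t = run type_nb w2 t.
  move=> /(monodromy_words_eq fs r_mon)/(_ (t, (0, false), true))/(congr1 (fun p => p.1.1)).
  by rewrite !run_type.
have keep (A : pred (bool * bool)) k : (forall i : 'I_3, i.+1 <> k -> {homo type_nb i : t / t \in A}) ->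
    forall w t, (forall i : 'I_3, i \in w -> i.+1 <> k) -> t \in A -> run type_nb w t \in A.
  move=> h; elim=> [//|i w IH] t wk tA /=; apply: IH.
    by move=> j jw; apply: wk; rewrite inE jw orbT.
  by apply: h => //; apply: wk; rewrite inE eqxx.
have separate (A : pred (bool * bool)) (i : 'I_3) t : (forall j : 'I_3, j.+1 <> i.+1 -> {homo type_nb j : t / t \in A}) ->
    t \in A -> type_nb i t \notin A -> ~ parabolic r i.+1 (r i).
  move=> hA tA /negP nA /par[w [wi e]]; apply: nA.
  rewrite -[type_nb i t]/(run type_nb [:: i] t) (typ [:: i] w) /=; last by rewrite mulg1.
  exact: keep hA _ _ wi tA.
have dih x : parabolic r 1 x -> dihedral r x.
  move: x; apply: generated_words => [_ [i _ <-]||x _ hx [i /= ni <-]].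
  - exact: inv.
  - by exists [::].
  - by apply: (dihedral_mul rel) hx => ei; case: ni; rewrite ei.
split=> //.
- have := rel_ac rel; rewrite /= mulg1 !mulgA -mulgA => /mulg1_eq <-.
  by rewrite invgM !(mulg1_eq (inv _)).
- exact: (monodromy_generated fs r_mon).
- move=> i; have [->|->|->] := ord3P i.
  + move=> /dih[w wD e].
    have rw t : run type_nb [:: i0] t = run type_nb w t.
      by apply: typ; rewrite /= mulg1.
    move: wD (rw (true, true)) (rw (false, true)); rewrite !inE.
    by move=> /orP[/eqP->|/orP[/eqP->|/orP[/eqP->|/orP[/eqP->|/orP[/eqP->|/orP[/eqP->|/orP[/eqP->|/eqP->]]]]]]].
  + apply: (@separate (pred2 (true, false) (true, true)) i1 (true, false)) => // j.
    by have [->|->|->] := ord3P j => ji [[] []] //=; case: ji.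
  + apply: (@separate (pred1 (true, true)) i2 (true, true)) => // j.
    by have [->|->|->] := ord3P j => ji [[] []] //=; case: ji.
move=> x x1 /par[w [w3 e]].
have [wd wdD ed] := dih x x1.
have : run type_nb wd (true, true) \in pred1 (true, true).
  rewrite (typ wd w) -?ed -?e //; apply: (keep _ 3%N) => //.
  by move=> i; have [->|->|->] := ord3P i => ji [[] []] //=; case: ji.
move: wdD ed; rewrite !inE.
by move=> /orP[/eqP->|/orP[/eqP->|/orP[/eqP->|/orP[/eqP->|/orP[/eqP->|/orP[/eqP->|/orP[/eqP->|/eqP->]]]]]]] //= ->;
  rewrite ?mulg1; auto.
Qed.

End AntiprismMonodromy.

(** The 48 words represent [3,4] = S_4 x C_2; the types see the factor S_4, and
    the central involution has odd length. *)
Lemma trivial_coset_word wd wr : wd \in dihedral_words -> wr \in transversal_words ->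
  (forall t, run type_nb (wd ++ wr) t = t) -> ~~ odd (size (wd ++ wr)) ->
  wd ++ wr = [::].
Proof.
move=> wdD wrT fix_t even.
have := fix_t (true, true); have := fix_t (true, false); have := fix_t (false, true).
pose check (u v : seq 'I_3) := [&& run type_nb (u ++ v) (false, true) == (false, true),
  run type_nb (u ++ v) (true, false) == (true, false),
  run type_nb (u ++ v) (true, true) == (true, true) & ~~ odd (size (u ++ v))]
  ==> (u ++ v == [::]).
have : all (fun u => all (check u) transversal_words) dihedral_words by vm_compute.
move=> /allP/(_ _ wdD)/allP/(_ _ wrT); rewrite /check even => /implyP h h1 h2 h3.
by apply/eqP/h; rewrite h1 h2 h3.
Qed.

Section Kernel.
Variable n : nat.
Hypothesis n_ge4 : (4 <= n)%N.
Local Notation nb := (@antiprism_nb n).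
Local Open Scope ring_scope.
Import GRing.Theory.

Lemma run_rotation i j k m t (x : antiprism_vertex n) :
  run nb (rotation_word i j k m) (t, x, true) =
  (t, off x (match t with
    | (true, true) => 6 * i%:Z | (true, false) => 6 * j%:Z
    | (false, false) => 6 * k%:Z | (false, true) => - (6 * m%:Z) end), true).
Proof.
have [a1 a2 a3 a4] := steps_wordA n_ge4; have [b1 b2 b3 b4] := steps_wordB n_ge4.
have [c1 c2 c3 c4] := steps_wordC n_ge4; have [d1 d2 d3 d4] := steps_wordD n_ge4.
rewrite /rotation_word !run_cat; case: t => [] [] [];
  [rewrite (run_power n_ge4 _ _ (a1^~ true)) (run_power n_ge4 _ _ (b1^~ true))
     (run_power n_ge4 _ _ (c1^~ true)) (run_power n_ge4 _ _ (d1^~ true))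
  |rewrite (run_power n_ge4 _ _ (a2^~ true)) (run_power n_ge4 _ _ (b2^~ true))
     (run_power n_ge4 _ _ (c2^~ true)) (run_power n_ge4 _ _ (d2^~ true))
  |rewrite (run_power n_ge4 _ _ (a4^~ true)) (run_power n_ge4 _ _ (b4^~ true))
     (run_power n_ge4 _ _ (c4^~ true)) (run_power n_ge4 _ _ (d4^~ true))
  |rewrite (run_power n_ge4 _ _ (a3^~ true)) (run_power n_ge4 _ _ (b3^~ true))
     (run_power n_ge4 _ _ (c3^~ true)) (run_power n_ge4 _ _ (d3^~ true))];
  rewrite !offD ?(leq_trans _ n_ge4) // !mul0r ?addr0 ?add0r mulr1 //.
by rewrite mulNr.
Qed.

(** Moving a flag by 6 i numbers modulo 2n is trivial only if n divides 3i, and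
    then lcm(3,n) divides 3i. *)
Lemma rotation_word_trivial (G : groupType) l (g : 'I_3 -> G) i j k m :
  (3 * l)%N = lcmn 3 n -> antiprism_relations (3 * l) g ->
  (forall p, run nb (rotation_word i j k m) p = p) ->
  wprod g (rotation_word i j k m) = 1%g.
Proof.
move=> el rel fix_p; have [oA oB oC oD] := word_order rel.
have fix_t t := fix_p (t, (0, false), true).
have dvd (y : nat) (c : int) : c = 6 * y%:Z \/ c = - (6 * y%:Z) ->
    off ((0, false) : antiprism_vertex n) c = (0, false) -> (l %| y)%N.
  move=> hc /eqP; rewrite off_id // => /dvdzP[q e].
  have n3y : (n %| 3 * y)%N.
    have : (n%:Z %| (3 * y)%N%:Z)%Z.
      by apply/dvdzP; case: hc e => -> e; [exists q|exists (- q)]; lia.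
    by rewrite dvdzE.
  have : (lcmn 3 n %| 3 * y)%N by rewrite dvdn_lcm dvdn_mulr.
  by rewrite -el dvdn_pmul2l.
have pow w y : (wprod g w ^+ l = 1)%g -> (l %| y)%N -> (wprod g w ^+ y = 1)%g.
  by move=> wl /dvdnP[q ->]; rewrite mulnC expgnA wl; elim: (q) => // q' IH; rewrite expgS mul1g.
have off_of t c x : (t, off x c, true) = (t, x, true) :> flag_index n -> off x c = x by case.
have di : (l %| i)%N.
  by have := fix_t (true, true); rewrite run_rotation => /off_of; apply: dvd; left.
have dj : (l %| j)%N.
  by have := fix_t (true, false); rewrite run_rotation => /off_of; apply: dvd; left.
have dk : (l %| k)%N.
  by have := fix_t (false, false); rewrite run_rotation => /off_of; apply: dvd; left.
have dm : (l %| m)%N.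
  by have := fix_t (false, true); rewrite run_rotation => /off_of; apply: dvd; right.
rewrite /rotation_word 3!wprod_cat 4!wprod_power.
by rewrite (pow _ _ oA di) (pow _ _ oB dj) (pow _ _ oC dk) (pow _ _ oD dm) !mulg1.
Qed.

(** The type and the orientation detect the coset word, since the rotations
    leave both unchanged; without the coset word, the exponents are detected. *)
Lemma trivial_run_normal_form (G : groupType) l (g : 'I_3 -> G) i j k m wd wr :
  (3 * l)%N = lcmn 3 n -> antiprism_relations (3 * l) g ->
  wd \in dihedral_words -> wr \in transversal_words ->
  (forall p, run nb (rotation_word i j k m ++ wd ++ wr) p = p) ->
  wprod g (rotation_word i j k m ++ wd ++ wr) = 1%g.
Proof.
move=> el rel wdD wrT fix_p.
have type_tr t : run type_nb (rotation_word i j k m) t = t.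
  have := run_type (rotation_word i j k m) (t, (0, false) : antiprism_vertex n, true).
  by rewrite run_rotation => <-.
have size_tr : ~~ odd (size (rotation_word i j k m)).
  have even_pow u y : ~~ odd (size u) -> ~~ odd (size (flatten (nseq y u))).
    by move=> hu; elim: y => //= y IH; rewrite size_cat oddD (negbTE hu).
  rewrite 3!size_cat 3!oddD (negbTE (even_pow _ wordA _ _)) //.
  rewrite (negbTE (even_pow _ wordB _ _)) // (negbTE (even_pow _ wordC _ _)) //.
  by rewrite (negbTE (even_pow _ wordD _ _)).
have e0 : wd ++ wr = [::].
  apply: trivial_coset_word => // [t|].
    have := run_type (rotation_word i j k m ++ wd ++ wr) (t, (0, false) : antiprism_vertex n, true).
    by rewrite fix_p run_cat type_tr => <-.
  have := orientation_run (rotation_word i j k m ++ wd ++ wr)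
    (((true, true), (0, false), true) : flag_index n).
  by rewrite fix_p size_cat oddD (negbTE size_tr) /=; case: odd.
move: fix_p; rewrite e0 cats0 => fix_p.
exact: rotation_word_trivial el rel fix_p.
Qed.
End Kernel.

(** The map from the presented group is well defined because the monodromies
    satisfy the relators, and injective because a normal form that acts trivially
    on the flags is trivial in every group satisfying the relations. *)
Theorem antiprism_monodromy_presentation n (hn : (4 <= n)%N)
    (r : 'I_3 -> Mon (antiprism n)) :
  (forall i, is_monodromy i (mon_fun (r i))) ->
  exists f : {multiplicative presented (antiprism_cover_relators (lcmn 3 n)) ->
      Mon (antiprism n)},
    bijective f /\ forall i, f (presented_gen _ i) = r i.
Proof.
move=> r_mon; set rels := antiprism_cover_relators _.
have fs := antiprism_flag_system hn.
pose l := (lcmn 3 n %/ 3)%N.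
have el : (3 * l)%N = lcmn 3 n by rewrite mulnC divnK // dvdn_lcml.
have lcm0 : (0 < lcmn 3 n)%N by rewrite lcmn_gt0; lia.
have l0 : (0 < l)%N by move: lcm0; rewrite -el; lia.
have rel_r : antiprism_relations (lcmn 3 n) r.
  by rewrite -el; apply: antiprism_mon_relations => //; rewrite el dvdn_lcmr.
pose g := presented_gen rels.
have rel_g : antiprism_relations (lcmn 3 n) g.
  by apply/antiprism_relators_eval => u; apply: relator_eval.
have [f fg] := presented_hom ((antiprism_relators_eval r _).2 rel_r).
exists f; split=> //.
have fw w : f (wprod g w) = wprod r w.
  rewrite wprod_morph; elim: w => //= i w ->; by rewrite /g fg.
have ker x : f x = 1 -> x = 1.
  have [w ->] := presented_generated_words x lcm0; rewrite -/rels -/g.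
  rewrite -el in rel_g.
  have [i [j [k [m [wd [wr [wdD wrT ->]]]]]]] := normal_form w rel_g l0.
  rewrite fw => e; apply: (trivial_run_normal_form hn el rel_g wdD wrT).
  by apply/(monodromy_words_eq fs r_mon _ [::]).
have inj : injective f.
  move=> x y e; apply: (mulIg y^-1); rewrite mulgV; apply: ker.
  apply: (mulIg (f y)); rewrite -gmulfM mulgVK e mul1g //.
have surj y : exists x, f x = y.
  have := monodromy_generated fs r_mon y.
  move: y; apply: generated_words => [_ [i _ <-]||_ _ [x <-] [i _ <-]].
  - exact: relations_invol rel_r i.
  - by exists (wprod g [::]); rewrite fw.
  - by exists (x * g i); rewrite gmulfM fg.
have [h hK] := choice surj.
by exists h => // x; apply: inj; rewrite hK.
Qed.

Theorem theorem11 (n : nat) (hn : (4 <= n)%N)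
    (d : Order.disp_t) (P : tbPOrderType d)
    (hP : minimal_regular_cover P (antiprism n))
    (Phi : flag P) (rho : 'I_3 -> Aut P) (hrho : distinguished Phi rho) :
  exists f : {multiplicative
      presented (antiprism_cover_relators (lcmn 3 n)) -> Aut P},
    bijective f /\ forall i, f (presented_gen _ i) = rho i.
Proof.
(* the covering of the antiprism by P supplies the maps r_i *)
have [r r_mon] : exists r : 'I_3 -> Mon (antiprism n), forall i, is_monodromy i (mon_fun (r i)).
  by have [_ [_ [rho0 [_ [f fmon]]]] _] := hP; exists (f \o rho0).
have fs := antiprism_flag_system hn.
have [f [fbij fr]] := minimal_cover_aut r_mon
  (fun i s s' => @monodromy_unique _ _ _ _ _ fs i s s')
  (antiprism_mon_C_group hn r_mon) hP hrho.
have [h [hbij hr]] := antiprism_monodromy_presentation hn r_mon.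
exists (f \o h); split; first exact: bij_comp.
by move=> i; rewrite /= hr fr.
Qed.
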